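(* Let $F:\mathbb{R}^n\to\mathbb{R}^n$ be a continuous vector field, and suppose that the dynamics $\dot{x}=F(x)$ generate an invertible and nonsingular flow $\varphi^t$. Let $X\subset\mathbb{R}^n$ be a compact set that is forward invariant under $\varphi^t$. Let the sample points $x_1,x_2,\dots$ be uniformly randomly distributed in $X$ and, for a sampling period $T_s>0$, let $y_k=\varphi^{T_s}(x_k)$ (no measurement noise). Let $g_1,g_2,\dots\in C^1(X)$ be basis functions satisfying $$\mu\left\{x\in X \ \Big|\ \sum_{l=1}^\infty c_l\,g_l(x)=0\right\}=0\qquad\forall\,(c_1,c_2,\dots)\ne \mathbf{0},$$ where $\mu$ is the Lebesgue measure. Let $f_j(x)=x_j$ denote the $j$-th coordinate function, $j\in\{1,\dots,n\}$. Let $\hat F_j(x_k)$ be the estimates of $F_j(x_k)$ produced by the dual lifting algorithm (described in the context) from the data pairs $\{(x_k,y_k)\}_{k=1}^K$ and the basis functions $g_1,\dots,g_N$. (1) If $N=K$ and $f_j$ is in the span of $\{g_l\}_{l=1}^N$, then, with probability one, $$\lim_{T_s\to0}\left|F_j(x_k)-\hat F_j(x_k)\right|=0\qquad\forall k .$$ (2) If $N\ge K$ and $\lim_{K\to\infty}\lim_{N\to\infty}\|\widetilde P_K f_j-f_j\|_L=0$ (with probability one), where $\widetilde P_K$ is the projection defined in the context and $\|f\|_L=\|f\|+\|Lf\|$ is the graph norm, with $\|\cdot\|$ the supremum norm on $C(X)$ and $Lf=F\cdot\nabla f$, then, with probability one, $$\lim_{K\to\infty}\ \lim_{N\to\infty}\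 \lim_{T_s\to0}\left|F_j(x_k)-\hat F_j(x_k)\right|=0\qquad\forall k$$ (the limit $T_s\to0$ is taken first, then $N\to\infty$, then $K\to\infty$).
   Context: Flow: $t\mapsto\varphi^t(x_0)$ is the solution of $\dot x=F(x)$ with initial condition $x_0$. Let $\mu$ be the Lebesgue measure on $\mathbb{R}^n$. The flow is nonsingular if $\mu(A)\ne0$ implies $\mu(\varphi^t(A))\neq 0$ for all (measurable) $A\subset\mathbb{R}^n$ and all $t>0$. It is invertible if each $\varphi^t$ is invertible, with inverse $\varphi^{-t}$. The set $X$ is forward invariant if $\varphi^t(X)\subseteq X$ for all $t>0$. ''Uniformly randomly distributed in $X$'' means that the $x_k$ are independent and distributed according to the normalized Lebesgue measure on $X$ (with $\mu(X)>0$). The sample points do not depend on $T_s$. Dual lifting algorithm. Given data pairs $\{(x_k,y_k)\}_{k=1}^K$, the sampling period $T_s$, and basis functions $g_1,\dots,g_N$ with $N\ge K$: 1. With $g(x)=(g_1(x),\dots,g_N(x))^T$, form the $K\times N$ matrices $P_x$ and $P_y$ whose $k$-th rows are $g(x_k)^T$ and $g(y_k)^T$, respectively. 2. Compute the $K\times K$ matrix $$\widetilde L_{data}=\frac1{T_s}\log\left(P_y P_x^\dagger\right),$$ where $\dagger$ denotes the Moore–Penrose pseudoinverse and $\log$ the principal matrix logarithm. 3. The estimates $\hat F(x_k)=(\hat F_1(x_k),\dots,\hat F_n(x_k))^T$, $k=1,\dots,K$, of the vector field at the sample points are given by $$\begin{pmatrix}\hat F(x_1)^T\\ \vdots\\ \hat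 F(x_K)^T\end{pmatrix}=\widetilde L_{data}\begin{pmatrix}x_1^T\\ \vdots\\ x_K^T\end{pmatrix}.$$ Projection $\widetilde P_K$. Let $\mathcal F=C(X)$ with the supremum norm, let $\mathcal F^*$ be its dual, and let $\xi_k\in\mathcal F^*$ be the evaluation functional $\xi_k(f)=f(x_k)$. The discrete projection $\widetilde P_K^*:\mathcal F^*\to\mathrm{span}\{\xi_1,\dots,\xi_K\}$ is $$\widetilde P_K^*\xi=\underset{\tilde\xi\in\mathrm{span}\{\xi_1,\dots,\xi_K\}}{\mathrm{argmin}}\ \sum_{l=1}^N|\xi(g_l)-\tilde\xi(g_l)|^2 .$$ The operator $\widetilde P_K:\mathcal F\to\mathcal F$ is the operator with $\xi(\widetilde P_Kf)=(\widetilde P_K^*\xi)(f)$ for all $f\in\mathcal F$, $\xi\in\mathcal F^*$. Explicitly, $\widetilde P_K f(x)=g(x)^TP_x^\dagger\,(f(x_1),\dots,f(x_K))^T$. It depends on both $K$ and $N$. The limits are understood in the sense that the quantities are defined when the parameters are sufficiently close to their limits (in particular, the logarithm for $T_s$ small enough). *)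

(* Defs.v *)
From HB Require Import structures.
From mathcomp Require Import all_boot all_order all_algebra.
From mathcomp Require Import complex.
From mathcomp Require Import all_classical all_reals all_analysis.
From mathcomp Require Import measurable_realfun.

Set Implicit Arguments.
Unset Strict Implicit.
Unset Printing Implicit Defensive.

Import Order.TTheory GRing.Theory Num.Theory.
Import numFieldNormedType.Exports.

Local Open Scope classical_set_scope.
Local Open Scope ring_scope.

Definition borel_rV (R : realType) (n : nat) := g_sigma_algebraType (@open 'rV[R]_n).

HB.instance Definition _ (R : realType) n := Measurable.on (borel_rV R n).

Lemma sigma_finite_product d1 d2 (T1 : measurableType d1)
    (T2 : measurableType d2) (R : realType)
    (m1 : {sigma_finite_measure set T1 -> \bar R})
    (m2 : {sigma_finite_measure set T2 -> \bar R}) :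
  sigma_finite setT (m1 \x m2)%E.
Proof.
have /sigma_finiteP[F [TF ndF Foo]] := sigma_finiteT m1.
have /sigma_finiteP[G [TG ndG Goo]] := sigma_finiteT m2.
exists (fun k => F k `*` G k).
  rewrite -setXTT TF TG predeqE => -[x y]; split.
    move=> [/= [k _ Fkx] [l _ Gly]]; exists (maxn k l) => //; split.
    - by move: x Fkx; exact/subsetPset/ndF/leq_maxl.
    - by move: y Gly; exact/subsetPset/ndG/leq_maxr.
  by move=> [k _ []/= ? ?]; split; exists k.
move=> k; have [? ?] := Foo k; have [? ?] := Goo k.
split; first exact: measurableX.
by rewrite product_measure1E// lte_mul_pinfty// ge0_fin_numE.
Qed.

Section lebesgue_rV.
Context {R : realType}.
Local Notation borel n := (borel_rV R n).

Lemma measurable_coord n (i : 'I_n) :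
  measurable_fun setT (fun v : borel n => (v : 'rV[R]_n) 0 i).
Proof.
apply: (measurability _ (RGenOpens.measurableE R)) => //.
move=> _ [_ [a [b ->] <-]]; rewrite setTI; apply: sub_gen_smallest.
by apply: open_comp; [move=> v _; exact: coord_continuous|exact: interval_open].
Qed.

Lemma measurable_rVP d (T : measurableType d) n (f : T -> 'rV[R]_n) :
  (forall i, measurable_fun setT (fun t => f t 0 i)) ->
  measurable_fun setT (f : T -> borel n).
Proof.
move=> mf; apply: (@measurability _ _ T (borel n) setT f (@open 'rV[R]_n)) => //.
move=> _ [U oU <-]; rewrite setTI.
pose B (qm : {ffun 'I_n -> rat} * nat) : set 'rV[R]_n :=
  [set v | forall i, `|v 0 i - ratr (qm.1 i)| < (qm.2.+1%:R : R)^-1].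
have -> : f @^-1` U =
    \bigcup_qm (if `[< B qm `<=` U >] then f @^-1` B qm else set0).
  rewrite eqEsubset; split => [t /= Uft|t [qm _]]; last first.
    by case: asboolP => // BU; exact: BU.
  have /nbhs_ballP[e /= e0 eU] : nbhs (f t) U by exact: open_nbhs_nbhs.
  have [m me] : exists m : nat, (m.+1%:R : R)^-1 < e / 2.
    by exists (Num.truncn (e / 2)^-1); rewrite invf_plt ?posrE ?divr_gt0// truncnS_gt.
  have /choice[q qP] : forall i, exists q : rat,
      `|f t 0 i - ratr q| < (m.+1%:R : R)^-1.
    move=> i.
    have [|q] := @rat_in_itvoo R (f t 0 i - m.+1%:R^-1) (f t 0 i + m.+1%:R^-1).
      by rewrite ltrBlDr -addrA ltrDl addr_gt0// invr_gt0.
    rewrite in_itv/= => /andP[h1 h2]; exists q.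
    by rewrite distrC ltr_distl h1.
  exists ([ffun i => q i], m) => //; case: asboolP => [_ i|].
    by rewrite /= ffunE.
  move=> nBU; exfalso; apply: nBU => v Bv; apply: eU; split=> // i j; rewrite ord1 /ball/=.
  rewrite (splitr e); apply: (lt_trans _ (ltrD me me)).
  have := Bv j; rewrite /= ffunE => bv.
  rewrite (le_lt_trans (ler_distD (ratr (q j)) _ _))// ltrD//.
  by rewrite distrC.
apply: countable_bigcupT_measurable => // -[q m].
case: asboolP => // _.
have -> : f @^-1` B (q, m) =
    \bigcap_(i in [set: 'I_n]) ((fun t => f t 0 i) @^-1` ball (ratr (q i) : R) (m.+1%:R^-1 : R)).
  rewrite eqEsubset; split => t /= h i => [_|].
    by have := h i; rewrite /ball/= distrC.
  by have := h i I; rewrite /ball/= distrC.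
apply: fin_bigcap_measurable => // i _.
rewrite -[X in measurable X]setTI; apply: mf => //.
exact: measurable_ball.
Qed.


Definition consv n (p : R * 'rV[R]_n) : 'rV[R]_n.+1 := row_mx p.1%:M p.2.
Definition unconsv n (v : 'rV[R]_n.+1) : R * 'rV[R]_n :=
  (v 0 0, rsubmx (v : 'rV_(1 + n))).

Lemma consv0 n (p : R * 'rV[R]_n) : consv p 0 ord0 = p.1.
Proof.
transitivity (row_mx p.1%:M p.2 0 (lshift n (0 : 'I_1))).
  by congr (row_mx _ _ _ _); exact: val_inj.
by rewrite row_mxEl mxE eqxx mulr1n.
Qed.

Lemma consvS n (p : R * 'rV[R]_n) i : consv p 0 (lift ord0 i) = p.2 0 i.
Proof.
transitivity (row_mx p.1%:M p.2 0 (rshift 1 i)).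
  by congr (row_mx _ _ _ _); exact: val_inj.
by rewrite row_mxEr.
Qed.

Lemma consvK n : cancel (@consv n) (@unconsv n).
Proof.
by move=> [a v]; rewrite /unconsv consv0 /consv row_mxKr.
Qed.

Lemma measurable_consv n :
  measurable_fun setT (@consv n : measurableTypeR R * borel n -> borel n.+1).
Proof.
apply: measurable_rVP => i; case: (unliftP ord0 i) => [k|] ->.
  rewrite (_ : (fun _ => _) = (fun v : borel n => (v : 'rV[R]_n) 0 k) \o snd).
    by apply: measurableT_comp => //; exact: measurable_coord.
  by apply/funext => p; rewrite consvS.
rewrite (_ : (fun _ => _) = fst)//.
by apply/funext => p; rewrite consv0.
Qed.

Lemma measurable_unconsv n :
  measurable_fun setT (@unconsv n : borel n.+1 -> measurableTypeR R * borel n).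
Proof.
apply/measurable_fun_pairP; split; first exact: measurable_coord.
apply: measurable_rVP => i.
rewrite (_ : (fun _ => _) = (fun v : borel n.+1 => v 0 (rshift 1 i))).
  exact: measurable_coord.
by apply/funext => v; rewrite mxE.
Qed.

Section step.
Context n (mu : {sigma_finite_measure set (borel n) -> \bar R}).

Definition lebesgue_consv := pushforward
  (@lebesgue_measure R \x mu)%E (@consv n : _ -> borel n.+1).

Let measurable_preimage_consv (A : set (borel n.+1)) : measurable A ->
  measurable (@consv n @^-1` A : set (measurableTypeR R * borel n)).
Proof. by move=> mA; rewrite -[X in measurable X]setTI; exact: measurable_consv. Qed.

Let lebesgue_consv0 : lebesgue_consv set0 = 0%E.
Proof. by rewrite /lebesgue_consv /pushforward preimage_set0 measure0. Qed.

Let lebesgue_consv_ge0 A : (0 <= lebesgue_consv A)%E.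
Proof. exact: (measure_ge0 (lebesgue_measure \x mu)%E). Qed.

Let lebesgue_consv_sigma_additive : semi_sigma_additive lebesgue_consv.
Proof.
move=> F mF tF mUF; rewrite /lebesgue_consv /pushforward preimage_bigcup.
apply: measure_semi_sigma_additive.
- by move=> k; exact: measurable_preimage_consv.
- apply/trivIsetP => /= i j _ _ ij; rewrite -preimage_setI.
  by move/trivIsetP : tF => /(_ _ _ _ _ ij) ->//; rewrite preimage_set0.
- by rewrite -preimage_bigcup; exact: measurable_preimage_consv.
Qed.

HB.instance Definition _ := isMeasure.Build _ _ _ lebesgue_consv
  lebesgue_consv0 lebesgue_consv_ge0 lebesgue_consv_sigma_additive.

Let lebesgue_consv_sigma_finite : sigma_finite setT lebesgue_consv.
Proof.
have := sigma_finite_product (@lebesgue_measure R) mu.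
move=> [G GT mG].
exists (fun k => @unconsv n @^-1` G k).
  by rewrite -preimage_bigcup -GT preimage_setT.
move=> k; have [mGk Gk_fin] := mG k; split.
  by rewrite -[X in measurable X]setTI; exact: measurable_unconsv.
rewrite /lebesgue_consv /pushforward -comp_preimage.
rewrite (_ : _ @^-1` _ = G k)//.
by apply/seteqP; split => p /=; rewrite consvK.
Qed.

HB.instance Definition _ := Measure_isSigmaFinite.Build _ _ _ lebesgue_consv
  lebesgue_consv_sigma_finite.

End step.


(* Lebesgue measure on the Borel sets of R^n, as the n-fold product of the
   one-dimensional one, transported along R x R^m ~ R^(m+1); lebesgue_rV_box
   computes it on boxes, which determines it. *)
Fixpoint lebesgue_rV n : {sigma_finite_measure set (borel n) -> \bar R} :=
  if n is m.+1 then lebesgue_consv (lebesgue_rV m) else \d_((0 : 'rV[R]_0) : borel 0).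

Lemma lebesgue_rV_box n (a b : 'I_n -> R) : (forall i, a i <= b i) ->
  lebesgue_rV n [set v | forall i, a i < (v : 'rV[R]_n) 0 i <= b i] =
  (\prod_i (b i - a i))%:E.
Proof.
elim: n a b => [|n IH] a b ab.
  by rewrite big_ord0 /= diracE mem_set//= => -[].
pose B := [set v : borel n |
  forall i, a (lift ord0 i) < (v : 'rV[R]_n) 0 i <= b (lift ord0 i)].
have mB : measurable B.
  rewrite (_ : B = \bigcap_(i in [set: 'I_n])
      (fun v : borel n => (v : 'rV[R]_n) 0 i) @^-1`
        `]a (lift ord0 i), b (lift ord0 i)]%classic).
    apply: fin_bigcap_measurable => // i _.
    by rewrite -[X in measurable X]setTI; exact: measurable_coord.
  by apply/seteqP; split => v /= h i; move: (h i); rewrite /= in_itv//=; apply.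
rewrite /= /lebesgue_consv /pushforward.
rewrite (_ : _ @^-1` _ = `]a ord0, b ord0]%classic `*` B); last first.
  apply/seteqP; split => -[t v] /=.
    move=> h; split; first by have := h ord0; rewrite consv0 in_itv.
    by move=> i; have := h (lift ord0 i); rewrite consvS.
  rewrite in_itv/= => -[ht hv] i; case: (unliftP ord0 i) => [k|] ->.
    by rewrite consvS; exact: hv.
  by rewrite consv0.
rewrite product_measure1E//= lebesgue_measure_itv/= lte_fin.
rewrite IH// big_ord_recl EFinM EFinB.
case: ltP => // ba; have -> : b ord0 = a ord0 by apply/eqP; rewrite eq_le ba ab.
by rewrite subee// mul0e.
Qed.

End lebesgue_rV.

Section pseudoinverse.
Context {R : realType}.

(* The four Penrose conditions, which characterize the Moore-Penrose inverse
   (pinvP, is_pinv_unique); mathcomp's pinvmx only satisfies the first one. *)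
Definition is_pinv m n (A : 'M[R]_(m, n)) (B : 'M[R]_(n, m)) :=
  [/\ A *m B *m A = A, B *m A *m B = B,
      (A *m B)^T = A *m B & (B *m A)^T = B *m A].

Definition pinv m n (A : 'M[R]_(m, n)) : 'M[R]_(n, m) :=
  get [set B | is_pinv A B].

Definition sqn n (u : 'rV[R]_n) : R := (u *m u^T) 0 0.

Lemma sqnE n (u : 'rV[R]_n) : sqn u = \sum_i u 0 i ^+ 2.
Proof. by rewrite /sqn mxE; apply: eq_bigr => i _; rewrite mxE expr2. Qed.

Lemma sqn_ge0 n (u : 'rV[R]_n) : 0 <= sqn u.
Proof. by rewrite sqnE sumr_ge0// => i _; exact: sqr_ge0. Qed.

Lemma sqn_eq0 n (u : 'rV[R]_n) : sqn u = 0 -> u = 0.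
Proof.
rewrite sqnE => /eqP; rewrite psumr_eq0 => [|i _]; last exact: sqr_ge0.
move=> /allP u0; apply/rowP => i; rewrite mxE; apply/eqP.
by rewrite -sqrf_eq0; exact: u0.
Qed.

Lemma gram_unitmx m n (A : 'M[R]_(m, n)) : row_free A -> A *m A^T \in unitmx.
Proof.
move=> fA; rewrite -row_free_unit; apply: inj_row_free => v vAA.
apply/eqP; rewrite -(mulmx_free_eq0 _ fA); apply/eqP/sqn_eq0.
by rewrite /sqn trmx_mul -mulmxA (mulmxA A) (mulmxA v) vAA mul0mx mxE.
Qed.

Lemma is_pinv_unique m n (A : 'M[R]_(m, n)) B C :
  is_pinv A B -> is_pinv A C -> B = C.
Proof.
move=> [ABA BAB AB BA] [ACA CAC AC CA].
have ABC : A *m B = A *m C.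
  have: (A *m C *m (A *m B))^T = A *m B by rewrite mulmxA ACA AB.
  by rewrite trmx_mul AB AC mulmxA ABA.
have BAC : B *m A = C *m A.
  have: (B *m A *m (C *m A))^T = B *m A by rewrite mulmxA -(mulmxA B) -mulmxA ACA BA.
  by rewrite trmx_mul CA BA mulmxA -(mulmxA C) -mulmxA ABA.
by rewrite -BAB BAC -mulmxA ABC mulmxA CAC.
Qed.

Lemma pinvP m n (A : 'M[R]_(m, n)) : is_pinv A (pinv A).
Proof.
suff [B AB] : exists B, is_pinv A B by exact: (getPex (ex_intro _ B AB)).
have [r [C [S [<- fS fC]]]] : exists (r : nat) (C : 'M[R]_(m, r)) (S : 'M[R]_(r, n)),
    [/\ C *m S = A, row_free S & row_free C^T].
  exists (\rank A), (col_base A), (row_base A); rewrite mulmx_base row_base_free.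
  by split=> //; rewrite /row_free mxrank_tr; exact: col_base_full.
have uG : S *m S^T \in unitmx by exact: gram_unitmx.
have uH : C^T *m C \in unitmx by rewrite -[X in _ *m X]trmxK; exact: gram_unitmx.
set G := S *m S^T in uG *; set H := C^T *m C in uH *.
have Gt : G^T = G by rewrite trmx_mul trmxK.
have Ht : H^T = H by rewrite trmx_mul trmxK.
pose B := S^T *m invmx G *m invmx H *m C^T.
have AB : C *m S *m B = C *m invmx H *m C^T.
  by rewrite /B !mulmxA -(mulmxA C S) -/G -(mulmxA C G) mulmxV// mulmx1.
have BA : B *m (C *m S) = S^T *m invmx G *m S.
  by rewrite /B !mulmxA -(mulmxA _ C^T C) -/H -(mulmxA _ (invmx H)) mulVmx// mulmx1.
exists B; split.
- by rewrite AB mulmxA -(mulmxA _ C^T C) -/H mulmxKV.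
- by rewrite BA /B !mulmxA -(mulmxA _ S S^T) -/G mulmxKV.
- by rewrite AB !trmx_mul trmxK trmx_inv Ht mulmxA.
- by rewrite BA !trmx_mul trmxK trmx_inv Gt mulmxA.
Qed.

Lemma mulmx_pinv m n (A : 'M[R]_(m, n)) : row_free A -> A *m pinv A = 1%:M.
Proof.
have [ABA _ _ _] := pinvP A.
by move=> fA; apply: (row_free_inj fA); rewrite ABA mul1mx.
Qed.

End pseudoinverse.

Section lifting.
Context {R : realType} {n : nat}.
Implicit Types (f h : 'rV[R]_n -> R) (z : 'rV[R]_n) (xi zeta : ('rV[R]_n -> R) -> R).

(* All sequences are indexed from 0: x k and g l stand for x_{k+1} and g_{l+1},
   and only x 0, ..., x (K - 1) and g 0, ..., g (N - 1) are used. *)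
Definition data_mx (g : nat -> 'rV[R]_n -> R) (K N : nat) (x : nat -> 'rV[R]_n) :
  'M[R]_(K, N) := \matrix_(k < K, l < N) g l (x k).

Definition eval_at z : ('rV[R]_n -> R) -> R := fun f => f z.

Definition eval_span (K : nat) (x : nat -> 'rV[R]_n) : set (('rV[R]_n -> R) -> R) :=
  [set zeta | exists a : 'I_K -> R,
     zeta = fun f => \sum_(k < K) a k * eval_at (x k) f].

Definition dual_residual (g : nat -> 'rV[R]_n -> R) (N : nat) xi zeta : R :=
  \sum_(l < N) `|xi (g l) - zeta (g l)| ^+ 2.

(* zeta is the discrete projection of xi. Continuity and linearity of xi play no
   role here, so xi is an arbitrary functional. The minimizer is unique when the
   data matrix has full row rank (dual_projE); otherwise dual_proj below picks
   one of the minimizers. *)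
Definition is_dual_proj g K N x xi zeta :=
  eval_span K x zeta /\
  forall zeta', eval_span K x zeta' ->
    dual_residual g N xi zeta <= dual_residual g N xi zeta'.

Definition dual_proj g K N x xi : ('rV[R]_n -> R) -> R :=
  xget (fun=> 0) [set zeta | is_dual_proj g K N x xi zeta].

(* The predual of dual_proj: xi (lift_proj f) = (dual_proj xi) f is imposed on
   evaluation functionals, which determines lift_proj f, and then holds for all
   linear xi (lift_proj_dual). *)
Definition lift_proj g K N x f : 'rV[R]_n -> R :=
  fun z => dual_proj g K N x (eval_at z) f.

Section explicit.
Context (g : nat -> 'rV[R]_n -> R) (K N : nat) (x : nat -> 'rV[R]_n).
Local Notation Px := (data_mx g K N x).
Local Notation comb a := (fun f => \sum_(k < K) a k * eval_at (x k) f).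

Let dual_residualE xi (a : 'I_K -> R) :
  dual_residual g N xi (comb a) = sqn (\row_l xi (g l) - (\row_k a k) *m Px).
Proof.
rewrite sqnE; apply: eq_bigr => l _; rewrite real_normK ?num_real// !mxE.
by congr ((_ - _) ^+ 2); apply: eq_bigr => k _; rewrite !mxE.
Qed.

Let sqn_pythagoras (u : 'rV[R]_N) (a : 'rV[R]_K) :
  sqn (u - a *m Px) =
  sqn (u - u *m pinv Px *m Px) + sqn ((u *m pinv Px - a) *m Px).
Proof.
have [ABA _ _ BA] := pinvP Px.
set r := u - u *m pinv Px *m Px; set s := (_ - a) *m Px.
have -> : u - a *m Px = r + s by rewrite /r /s mulmxBl addrA subrK.
have rs : r *m s^T = 0.
  rewrite /s trmx_mul mulmxA (_ : r *m Px^T = 0) ?mul0mx//.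
  have PPP : pinv Px *m Px *m Px^T = Px^T by rewrite -BA -trmx_mul mulmxA ABA.
  by rewrite /r mulmxBl -(mulmxA u) -(mulmxA u) PPP subrr.
have sr : s *m r^T = 0 by apply: trmx_inj; rewrite trmx_mul trmxK rs trmx0.
rewrite /sqn [in LHS]linearD/= mulmxDl !mulmxDr rs sr addr0 add0r.
by rewrite mxE.
Qed.

Lemma dual_projE xi : row_free Px -> dual_proj g K N x xi =
  fun f => ((\row_l xi (g l)) *m pinv Px *m (\col_k f (x k))) 0 0.
Proof.
move=> fP; set u := \row_l xi (g l); pose a0 k := (u *m pinv Px) 0 k.
have a0E : \row_k a0 k = u *m pinv Px by apply/rowP => k; rewrite mxE.
have -> : (fun f => (u *m pinv Px *m (\col_k f (x k))) 0 0) = comb a0.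
  by apply/funext => f; rewrite mxE; apply: eq_bigr => k _; rewrite [X in _ * X]mxE.
apply: xget_unique.
  split; first by exists a0.
  move=> _ [a ->]; rewrite !dual_residualE a0E [leRHS]sqn_pythagoras.
  by rewrite lerDl sqn_ge0.
move=> _ [[a ->]] /(_ _ (ex_intro _ a0 erefl)).
rewrite !dual_residualE a0E sqn_pythagoras -/u gerDl => s0.
have /sqn_eq0/eqP : sqn ((u *m pinv Px - \row_k a k) *m Px) = 0.
  by apply/eqP; rewrite eq_le s0 sqn_ge0.
rewrite mulmx_free_eq0// subr_eq0 => /eqP/rowP aE.
apply/funext => f; apply: eq_bigr => k _; congr (_ * _).
by rewrite /a0 aE mxE.
Qed.

Lemma lift_projE f z : row_free Px -> lift_proj g K N x f z =
  ((\row_l g l z) *m pinv Px *m (\col_k f (x k))) 0 0.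
Proof. by move=> fP; rewrite /lift_proj dual_projE. Qed.

Lemma lift_proj_dual (xi : {linear ('rV[R]_n -> R) -> R^o}) f : row_free Px ->
  xi (lift_proj g K N x f) = dual_proj g K N x xi f.
Proof.
move=> fP; rewrite dual_projE//.
pose c := pinv Px *m (\col_k f (x k)).
have -> : lift_proj g K N x f = \sum_(l < N) c l 0 *: (g l : 'rV[R]_n -> R).
  apply/funext => z; rewrite lift_projE// -mulmxA mxE fct_sumE.
  by apply: eq_bigr => l _; rewrite mxE mulrC.
rewrite linear_sum -mulmxA mxE; apply: eq_bigr => l _.
by rewrite linearZ [X in _ = X * _]mxE mulrC.
Qed.

End explicit.

End lifting.

Section matrix_logarithm.
Context {R : realType}.

Definition mexp K (B : 'M[R]_K) : 'M[R]_K :=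
  limn (series (fun m => (m`!%:R : R)^-1 *: B ^+ m)).

(* A real matrix has a principal logarithm iff it has no eigenvalue in
   ]-oo, 0]; this logarithm is then real, and it is the only logarithm whose
   complex eigenvalues all lie in the open strip |Im z| < pi. *)
Definition is_mlog K (A B : 'M[R]_K) :=
  mexp B = A /\
  forall z : R[i], eigenvalue (map_mx (real_complex R) B) z ->
    `|complex.Im z| < pi.

Definition has_mlog K (A : 'M[R]_K) := exists B, is_mlog A B.

Definition mlog K (A : 'M[R]_K) : 'M[R]_K := get [set B | is_mlog A B].

End matrix_logarithm.

Section dual_lifting.
Context {R : realType} {n : nat}.
Implicit Types (g : nat -> 'rV[R]_n -> R) (x y : nat -> 'rV[R]_n).

Definition lift_ratio g K N x y : 'M[R]_K :=
  data_mx g K N y *m pinv (data_mx g K N x).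

Definition lift_gen g K N (Ts : R) x y : 'M[R]_K :=
  Ts^-1 *: mlog (lift_ratio g K N x y).

(* Row k, counted from 0, is the estimate of F (x k). *)
Definition lift_est g K N (Ts : R) x y : 'M[R]_(K, n) :=
  lift_gen g K N Ts x y *m \matrix_(k < K) x k.

End dual_lifting.

Section dynamics.
Context {R : realType} {n : nat}.
Implicit Types (F : 'rV[R]_n -> 'rV[R]_n) (phi : R -> 'rV[R]_n -> 'rV[R]_n).
Implicit Types (X : set 'rV[R]_n) (f : 'rV[R]_n -> R).

(* F is only assumed continuous, so that uniqueness of the solution through
   x0 has to be part of the definition. *)
Definition is_flow F phi := forall x0,
  [/\ phi 0 x0 = x0,
      forall t : R, is_derive t 1 (fun s => phi s x0) (F (phi t x0)) &
      forall c : R -> 'rV[R]_n, c 0 = x0 ->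
        (forall t : R, is_derive t 1 c (F (c t))) ->
        forall t, c t = phi t x0].

Definition flow_invertible phi := forall t, cancel (phi t) (phi (- t)).

Definition flow_nonsingular phi :=
  forall (A : set (borel_rV R n)) (t : R), measurable A -> 0 < t ->
    lebesgue_rV n A <> 0%E -> lebesgue_rV n (phi t @` A) <> 0%E.

Definition forward_invariant phi X := forall t, 0 < t -> phi t @` X `<=` X.

(* C^1(X) for a compact set X: restrictions to X of functions that are
   continuously differentiable on a neighbourhood of X. *)
Definition C1_near X f := exists U : set 'rV[R]_n,
  [/\ open U, X `<=` U &
      forall z, U z -> differentiable f z /\
        forall i, {for z, continuous (fun w => 'D_(delta_mx 0 i) f w)}].

(* L f = F . grad f, the i-th partial derivative being 'D_(delta_mx 0 i). *)
Definition koopman_gen F f : 'rV[R]_n -> R :=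
  fun z => \sum_(i < n) F z 0 i * 'D_(delta_mx 0 i) f z.

Definition sup_norm X f : \bar R := ereal_sup [set `|f z|%:E | z in X].

Definition graph_norm F X f : \bar R :=
  (sup_norm X f + sup_norm X (koopman_gen F f))%E.

Definition coord_fun (j : 'I_n) : 'rV[R]_n -> R := fun z => z 0 j.

(* The set consists of the points at which the series converges, to 0. *)
Definition basis_nondegenerate X (g : nat -> 'rV[R]_n -> R) :=
  forall c : nat -> R, (exists l, c l != 0) ->
    lebesgue_rV n [set z | X z /\ series (fun l => c l * g l z) @ \oo --> 0]
    = 0%E.

Definition in_span X (g : nat -> 'rV[R]_n -> R) N f :=
  exists c : 'I_N -> R, forall z, X z -> f z = \sum_(l < N) c l * g l z.

End dynamics.

Section sampling.
Context d (Omega : measurableType d) (R : realType) (P : probability Omega R).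
Context (n : nat).

Definition mutually_independent (x : nat -> {RV P >-> borel_rV R n}) :=
  forall (s : seq nat) (A : nat -> set (borel_rV R n)), uniq s ->
    (forall k, measurable (A k)) ->
    P (\bigcap_(k in [set` s]) x k @^-1` A k) =
    (\prod_(k <- s) P (x k @^-1` A k))%E.

Definition uniform_on (X : set 'rV[R]_n) (x : {RV P >-> borel_rV R n}) :=
  forall A : set (borel_rV R n), measurable A ->
    distribution P x A = (lebesgue_rV n (A `&` X) / lebesgue_rV n X)%E.

End sampling.

(* Main.v *)
(* With probability one every leading matrix (g_l(x_k)), k, l = 1, ..., K, is invertible: its
   determinant, as a function of the last sample point, is a combination of
   g_1, ..., g_K whose last coefficient is the previous determinant, and the last
   point is independent of the others. Hence P_x has full row rank, P_y P_x^+ tends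
   to 1 as T_s -> 0, and its difference quotient tends to D P_x^+ with
   D = ((L g_l)(x_k)), by differentiating g_l along the flow. The principal logarithm
   satisfies log A = (A - 1) + O(|A - 1|^2) near 1, so the estimates converge to
   (D P_x^+ f_j(x))_k = (L (P_K f_j))(x_k). If N = K and f_j is in the span of the
   g_l, then P_K f_j = f_j on X; in general the error is at most the graph norm of
   P_K f_j - f_j.
   The expansion of the logarithm comes from a contraction argument, which yields a
   small logarithm of A commuting with the commutant of A, and from the uniqueness of
   a logarithm with eigenvalues in the strip |Im z| < pi among commuting matrices. *)
Require Import Defs.
From HB Require Import structures.
From mathcomp Require Import all_boot all_order all_algebra.
From mathcomp Require Import complex.
From mathcomp Require Import all_classical all_reals all_analysis.
From mathcomp Require Import measurable_realfun.
From mathcomp Require Import ring lra.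

Set Implicit Arguments.
Unset Strict Implicit.
Unset Printing Implicit Defensive.

Import Order.TTheory GRing.Theory Num.Theory.
Import numFieldNormedType.Exports.

Local Open Scope classical_set_scope.
Local Open Scope ring_scope.

(** * Matrix exponential *)

HB.instance Definition _ (R : realType) m n :=
  Complete.copy (matrix R m n) (matrix R m n).

Section matrix_limits.
Context {R : realType}.

Lemma mx_norm_le m n (A : 'M[R]_(m, n)) (e : R) : 0 <= e ->
  (forall i j, `|A i j| <= e) -> `|A| <= e.
Proof.
by move=> e0 Ae; rewrite /Num.norm/= mx_normrE; apply: bigmax_le => // -[i j] _; exact: Ae.
Qed.

Lemma mx_norm_ge m n (A : 'M[R]_(m, n)) i j : `|A i j| <= `|A|.
Proof.
by rewrite [leRHS]/Num.norm/= mx_normrE; apply/bigmax_geP; right; exists (i, j).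
Qed.

(** The norm is the largest absolute value of an entry, so submultiplicativity costs the inner
    dimension as a factor. *)
Lemma mx_normM m p q (A : 'M[R]_(m, p)) (B : 'M[R]_(p, q)) :
  `|A *m B| <= p%:R * `|A| * `|B|.
Proof.
apply: mx_norm_le => [|i j]; first by rewrite !mulr_ge0.
rewrite mxE (le_trans (ler_norm_sum _ _ _))//.
rewrite (@le_trans _ _ (\sum_(k < p) `|A| * `|B|))//.
  by apply: ler_sum => k _; rewrite normrM ler_pM ?mx_norm_ge.
by rewrite sumr_const card_ord -mulrA mulr_natl.
Qed.

Context {T : Type} {D : set_system T} {FD : Filter D}.

Lemma cvg_mxP m n (f : T -> 'M[R]_(m, n)) (l : 'M[R]_(m, n)) :
  f @ D --> l <-> forall i j, (fun t => f t i j) @ D --> l i j.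
Proof.
split=> [fl i j|fl]; apply/cvgrPdist_le => e e0.
  near=> t; have -> : l i j - f t i j = (l - f t) i j by rewrite !mxE.
  apply: (le_trans (mx_norm_ge _ _ _)).
  by near: t; move/cvgrPdist_le : fl; exact.
suff : \forall t \near D, forall ij : 'I_m * 'I_n, `|l ij.1 ij.2 - f t ij.1 ij.2| <= e.
  apply: filterS => t lt; apply: mx_norm_le => [|i j]; first exact: ltW.
  by rewrite !mxE; exact: (lt (i, j)).
by apply: filter_forall => -[i j] /=; move/cvgrPdist_le : (fl i j); exact.
Unshelve. all: by end_near. Qed.

Lemma cvg_mulmx m p q (f : T -> 'M[R]_(m, p)) (h : T -> 'M[R]_(p, q))
    (a : 'M[R]_(m, p)) (b : 'M[R]_(p, q)) :
  f @ D --> a -> h @ D --> b -> (fun t => f t *m h t) @ D --> a *m b.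
Proof.
move=> /cvg_mxP fa /cvg_mxP hb; apply/cvg_mxP => i j.
rewrite mxE; under eq_fun do rewrite mxE.
by apply: cvg_big => [|k _]; [exact: add_continuous|apply: cvgM; [exact: fa|exact: hb]].
Qed.

End matrix_limits.

Lemma norm_lim_le {R : realType} {V : normedModType R} {T : Type}
    {D : set_system T} {FD : ProperFilter D} (f : T -> V) l (e : R) :
  f @ D --> l -> (\forall t \near D, `|f t| <= e) -> `|l| <= e.
Proof.
move=> fl fe.
have cl : closed ([set v : V | `|v| <= e]).
  apply: (@closed_comp _ _ (Num.norm : V -> R) [set x | x <= e]).
    by move=> v _; exact: norm_continuous.
  exact: closed_le.
exact: (@closed_cvg _ _ _ _ f _ cl fe l fl).
Qed.

Section matrix_exponential.
Context {R : realType} {K : nat}.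
Implicit Types A B C E : 'M[R]_K.

Definition mexp_term B m : 'M[R]_K := (m`!%:R : R)^-1 *: B ^+ m.

(** [K + 1] instead of [K] gives [c >= 1] even for empty matrices; [c] times the norm is
    submultiplicative. *)
Let c : R := K.+1%:R.

Let c_ge1 : 1 <= c. Proof. by rewrite ler1n. Qed.

Let normM A B : `|A *m B| <= c * `|A| * `|B|.
Proof. by rewrite (le_trans (mx_normM _ _))// !ler_wpM2r// ler_nat. Qed.

Lemma mx_normX B m : `|B ^+ m| <= (c * `|B|) ^+ m.
Proof.
elim: m => [|m IH].
  rewrite expr0; apply: mx_norm_le => // i j.
  by rewrite mxE; case: eqP => _; rewrite ?normr1 ?normr0// ler01.
by rewrite exprS (le_trans (normM _ _))// exprS ler_wpM2l// mulr_ge0.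
Qed.

Lemma cvg_mexp B : series (mexp_term B) @ \oo --> mexp B.
Proof.
apply: normed_cvg.
apply: (@series_le_cvg _ _ (exp_coeff (c * `|B|))) => //.
- by move=> m; exact: normr_ge0.
- by move=> m; apply: exp_coeff_ge0; rewrite mulr_ge0.
- move=> m /=; rewrite /mexp_term normrZ ger0_norm ?invr_ge0//.
  by rewrite /exp_coeff/= [leRHS]mulrC ler_wpM2l ?invr_ge0// mx_normX.
- exact: is_cvg_series_exp_coeff.
Qed.

(** Telescoping by [B^(m+2) - C^(m+2) = B (B^(m+1) - C^(m+1)) + (B - C) C^(m+1)], an identity valid
    for noncommuting matrices. *)
Lemma mx_normXB B C rho m : c * `|B| <= rho -> c * `|C| <= rho ->
  `|B ^+ m.+1 - C ^+ m.+1| <= m.+1%:R * rho ^+ m * (c * `|B - C|).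
Proof.
move=> Br Cr; have r0 : 0 <= rho by rewrite (le_trans _ Br)// mulr_ge0.
elim: m => [|m IH].
  by rewrite !expr1 expr0 !mul1r ler_peMl.
rewrite exprS [in X in _ - X]exprS.
rewrite [X in `|X|](_ : _ = B * (B ^+ m.+1 - C ^+ m.+1) + (B - C) * C ^+ m.+1); last first.
  by rewrite mulrBr mulrBl addrA subrK.
rewrite (_ : m.+2%:R * _ * _ = rho * (m.+1%:R * rho ^+ m * (c * `|B - C|)) +
    c * `|B - C| * rho ^+ m.+1); last by rewrite -[m.+2%:R]natr1 exprS; ring.
rewrite (le_trans (ler_normD _ _))// lerD// (le_trans (normM _ _))//.
  by rewrite ler_pM ?mulr_ge0.
rewrite ler_wpM2l ?mulr_ge0// (le_trans (mx_normX _ _))// lerXn2r ?nnegrE//.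
by rewrite mulr_ge0.
Qed.

(** The terms of orders 0 and 1 cancel. In the term of order [m + 2] the factorial absorbs the
    factor [m + 2] of [mx_normXB], which leaves the geometric sum [rho + rho^2 + ... <= 2 rho]. *)
Lemma mexp_remainder_lip B C rho :
  c * `|B| <= rho -> c * `|C| <= rho -> rho <= 2^-1 ->
  `|(mexp B - B) - (mexp C - C)| <= 2 * rho * c * `|B - C|.
Proof.
move=> Br Cr r2; have r0 : 0 <= rho by rewrite (le_trans _ Br)// mulr_ge0.
have geo n : \sum_(0 <= m < n) rho ^+ m.+1 <= 2 * rho.
  suff : \sum_(0 <= m < n) rho ^+ m.+1 <= 2 * rho - 2 * rho ^+ n.+1.
    by move=> /le_trans; apply; rewrite gerBl mulr_ge0// exprn_ge0.
  elim: n => [|n IH]; first by rewrite big_nil expr1 subrr.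
  rewrite big_nat_recr//= (le_trans (lerD IH (lexx _)))// -addrA lerD2l.
  rewrite [in leRHS]exprS.
  have := ler_wpM2r (exprn_ge0 n.+1 r0) r2; lra.
apply: (@norm_lim_le _ _ _ \oo _
   (fun n => (series (mexp_term B) n - B) - (series (mexp_term C) n - C))).
  apply: cvgB; apply: cvgB; try exact: cvg_mexp; exact: cvg_cst.
exists 2 => // n /= n2; rewrite -(subnK n2) addn2; move: (n - 2)%N => {n n2} n.
have SE A : series (mexp_term A) n.+2 - A = 1 + \sum_(0 <= m < n) mexp_term A m.+2.
  rewrite /series/= !big_nat_recl// {1 2}/mexp_term !fact0 factS fact0 muln1 invr1.
  by rewrite !scale1r expr0 expr1 [A + _]addrC addrA addrK.
rewrite !SE opprD addrACA subrr add0r -sumrB (le_trans (ler_norm_sum _ _ _))//.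
apply: (@le_trans _ _ (\sum_(0 <= m < n) rho ^+ m.+1 * (c * `|B - C|))).
  apply: ler_sum => m _; rewrite /mexp_term -scalerBr normrZ.
  have f0 : 0 < (m.+2)`!%:R :> R by rewrite ltr0n fact_gt0.
  rewrite ger0_norm; last by rewrite invr_ge0 ltW.
  rewrite ler_pdivrMl//.
  rewrite (le_trans (mx_normXB _ Br Cr))// -mulrA.
  rewrite ler_wpM2r ?mulr_ge0 ?exprn_ge0// ler_nat factS.
by rewrite leq_pmulr// fact_gt0.
by rewrite -mulr_suml -[leRHS]mulrA ler_wpM2r ?mulr_ge0// geo.
Qed.

Lemma mexp0 : mexp (0 : 'M[R]_K) = 1.
Proof.
apply: (cvg_unique _ (@cvg_mexp 0)) => //=.
rewrite -cvg_shiftS; apply: cvg_near_cst; apply: nearW => n.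
rewrite /series/= big_nat_recl// /mexp_term expr0 fact0 invr1 scale1r.
by rewrite big1 ?addr0// => m _; rewrite exprS mul0r scaler0.
Qed.

Lemma comm_mexp B C : B *m C = C *m B -> mexp B *m C = C *m mexp B.
Proof.
move=> BC.
have H1 : (fun n => series (mexp_term B) n *m C) @ \oo --> mexp B *m C.
  by apply: cvg_mulmx; [exact: cvg_mexp|exact: cvg_cst].
have H2 : (fun n => C *m series (mexp_term B) n) @ \oo --> C *m mexp B.
  by apply: cvg_mulmx; [exact: cvg_cst|exact: cvg_mexp].
suff H12 : (fun n => series (mexp_term B) n *m C) = (fun n => C *m series (mexp_term B) n).
  by rewrite H12 in H1; exact: cvg_unique H1 H2.
apply/funext => n; rewrite /series/= mulmx_sumr mulmx_suml; apply: eq_bigr => m _.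
rewrite /mexp_term -scalemxAl -scalemxAr; congr (_ *: _).
by elim: m => [|m IH]; rewrite ?expr0 ?mulmx1 ?mul1mx// exprS -mulmxA IH !mulmxA BC.
Qed.

(* A fixed point of [B |-> A - mexp B + B] is a logarithm of [A]; this map is a
   contraction because [mexp B - B] is almost constant near [0]. Commutation with
   the commutant of [A] is a closed condition, preserved by the map. *)
Lemma mexp_near1 A : `|A - 1| <= (8 * c ^+ 2)^-1 ->
  exists L, [/\ mexp L = A, `|L| <= 2 * `|A - 1|,
    `|L - (A - 1)| <= 8 * c ^+ 2 * `|A - 1| ^+ 2 &
    forall C, A *m C = C *m A -> L *m C = C *m L].
Proof.
move=> Ad; set e := `|A - 1| in Ad *.
have e0 : 0 <= e by exact: normr_ge0.
have c2 : 0 < c ^+ 2 by rewrite exprn_gt0// (lt_le_trans _ c_ge1).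
have c2e : 8 * c ^+ 2 * e <= 1.
  by rewrite -[leRHS](mulfV (lt0r_neq0 (mulr_gt0 (ltr0Sn _ 7) c2))) ler_wpM2l// mulr_ge0// ltW.
have ce0 : 0 <= c * e by rewrite mulr_ge0.
(* [rho] bounds [c * |B|] on the ball of radius [2 e]. Since [8 c^2 e <= 1], the Lipschitz constant
   [2 rho c = 4 c^2 e] of the remainder is at most 1/2, so [f] contracts the ball into itself. *)
pose rho := c * (2 * e).
have rho2 : rho <= 2^-1.
  have := ler_wpM2r ce0 c_ge1; rewrite /rho; lra.
pose U := [set B : 'M[R]_K | `|B| <= 2 * e /\
  forall C, A *m C = C *m A -> B *m C = C *m B].
pose f B := A - mexp B + B.
have Brho B : `|B| <= 2 * e -> c * `|B| <= rho by move=> ?; rewrite ler_wpM2l.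
have rem B : `|B| <= 2 * e -> `|f B - (A - 1)| <= 2 * rho * c * `|B|.
  move=> Be; have := mexp_remainder_lip (Brho _ Be) (Brho 0 _) rho2.
  rewrite mexp0 !subr0 normr0 -normrN => /(_ (mulr_ge0 _ e0)).
  rewrite (_ : - (mexp B - B - 1) = f B - (A - 1)); first exact.
  by rewrite /f; rewrite !opprB addrA -[RHS](addrC (1 - A)) !addrA addrNK addrAC.
have rho4 : 2 * rho * c <= 2^-1 by rewrite /rho; lra.
have fU : set_fun U U f.
  move=> B [Be BC]; split.
    rewrite -[f B](subrK (A - 1)) (le_trans (ler_normD _ _))//.
    rewrite mulrDl mul1r lerD// (le_trans (rem _ Be))//.
    rewrite (le_trans (ler_wpM2r _ rho4))//; lra.
  move=> C AC; have LC := BC _ AC; have eC := comm_mexp LC.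
  by rewrite /f mulmxDl mulmxBl mulmxDr mulmxBr AC eC LC.
have [|||L [Le LC] Lf] := @banach_fixed_point _ _ U (mkfun fU).
- exists (2^-1)%:nng; split; first by rewrite /= invf_lt1// ltr1n.
  move=> [B C] /= [[Be _] [Ce _]].
  have := mexp_remainder_lip (Brho _ Be) (Brho _ Ce) rho2.
  rewrite /mkfun /f -normrN opprB.
  rewrite (_ : mexp C - C - (mexp B - B) = A - mexp B + B - (A - mexp C + C)).
    by move=> /le_trans; apply; rewrite ler_wpM2r.
  by apply/matrixP => i j; rewrite !mxE; ring.
- rewrite (_ : U = [set B | `|B| <= 2 * e] `&`
      \bigcap_(C in [set C | A *m C = C *m A]) [set B | B *m C - C *m B = 0]); last first.
    apply/seteqP; split => B [Be BC]; split => // C /BC; first by move=> /= ->; rewrite subrr.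
    by move=> /eqP; rewrite subr_eq0 => /eqP.
  apply: closedI.
    rewrite (_ : [set _ | _] = Num.norm @^-1` [set x | x <= 2 * e])//.
    by apply: closed_comp => [v _|]; [exact: norm_continuous|exact: closed_le].
  apply: closed_bigI => C _.
  apply: (@closed_comp _ _ (fun B : 'M[R]_K => B *m C - C *m B) [set 0]).
    move=> B _.
    have FB : Filter (nbhs B) := nbhs_filter B.
    have H1 : (fun B : 'M[R]_K => B *m C) @ B --> B *m C.
      exact: (@cvg_mulmx _ _ _ FB _ _ _ _ _ _ _ (@cvg_id _ (nbhs B)) (@cvg_cst _ C _ _ FB)).
    have H2 : (fun B : 'M[R]_K => C *m B) @ B --> C *m B.
      exact: (@cvg_mulmx _ _ _ FB _ _ _ _ _ _ _ (@cvg_cst _ C _ _ FB) (@cvg_id _ (nbhs B))).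
    exact: (@cvgB _ _ _ _ FB _ _ _ _ H1 H2).
  exact/accessible_closed_set1/hausdorff_accessible/norm_hausdorff.
- exists 0; split; first by rewrite normr0 mulr_ge0.
  by move=> C _; rewrite mul0mx mulmx0.
exists L; split => //.
- by move/eqP: Lf; rewrite /mkfun /f eq_sym -subr_eq0 addrK subr_eq0 => /eqP.
- rewrite {1}Lf (le_trans (rem _ Le))// (le_trans (ler_wpM2l _ Le)) ?mulr_ge0//.
  by rewrite /rho; lra.
Qed.

End matrix_exponential.

(** * Uniqueness of the principal logarithm *)

Section complex_exponential.
Context {R : realType}.
Implicit Types z w : R[i].
Local Notation Re := (@complex.Re R).
Local Notation Im := (@complex.Im R).

Lemma ReD z w : Re (z + w) = Re z + Re w. Proof. by case: z; case: w. Qed.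
Lemma ImD z w : Im (z + w) = Im z + Im w. Proof. by case: z; case: w. Qed.
Lemma ReM z w : Re (z * w) = Re z * Re w - Im z * Im w.
Proof. by case: z; case: w. Qed.
Lemma ImM z w : Im (z * w) = Re z * Im w + Im z * Re w.
Proof. by case: z; case: w. Qed.

Lemma Re_sum I (r : seq I) (P : pred I) (F : I -> R[i]) :
  Re (\sum_(i <- r | P i) F i) = \sum_(i <- r | P i) Re (F i).
Proof. exact: (big_morph Re ReD). Qed.

Lemma Im_sum I (r : seq I) (P : pred I) (F : I -> R[i]) :
  Im (\sum_(i <- r | P i) F i) = \sum_(i <- r | P i) Im (F i).
Proof. exact: (big_morph Im ImD). Qed.

(** The complex exponential in real terms; [cvg_cexp] identifies it with the sum of its power
    series. *)
Definition cexp z : R[i] :=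
  Complex (expR (Re z) * cos (Im z)) (expR (Re z) * sin (Im z)).

Lemma cexp_neq0 z : cexp z != 0.
Proof.
rewrite eq_complex /= !mulf_eq0 !(gt_eqF (expR_gt0 _))/=.
apply/negP => /andP[/eqP c0 /eqP s0].
have := cos2Dsin2 (Im z); rewrite c0 s0 !expr0n/= addr0 => /eqP.
by rewrite eq_sym oner_eq0.
Qed.

(** Comparing squared moduli gives equal real parts. The difference of the imaginary parts then has
    cosine 1, so its half is a zero of the sine in []-pi, pi[], that is, 0. *)
Lemma cexp_inj z w : `|Im z| < pi -> `|Im w| < pi -> cexp z = cexp w -> z = w.
Proof.
case: z => a b; case: w => a' b' /= bpi b'pi [ec es].
have ab : a = a'.
  have : expR a ^+ 2 = expR a' ^+ 2.
    rewrite -[LHS]mulr1 -(cos2Dsin2 b) -[RHS]mulr1 -(cos2Dsin2 b') !mulrDr.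
    by rewrite -!exprMn ec es.
  move=> /eqP; rewrite eqrXn2 ?expR_ge0// => /eqP; exact: expR_inj.
move: ec es; rewrite -ab => /(mulfI (lt0r_neq0 (expR_gt0 a))) ec.
move=> /(mulfI (lt0r_neq0 (expR_gt0 a))) es.
have s0 : sin ((b - b') / 2) = 0.
  have : cos (b - b') = 1 by rewrite cosB ec es -!expr2 cos2Dsin2.
  rewrite -{1}[b - b'](@divfK _ 2)// mulr_natr cos_mulr2n => c1.
  have := cos2Dsin2 ((b - b') / 2).
  have -> : cos ((b - b') / 2) ^+ 2 = 1 by move: c1; rewrite -mulr_natr; lra.
  move=> s2; apply/eqP; rewrite -sqrf_eq0; apply/eqP; lra.
have [bb|bb|<-//] := ltgtP b b'.
  have : 0 < sin ((b' - b) / 2).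
    apply: sin_gt0_pi; rewrite ?divr_gt0 ?subr_gt0//.
    by move: bpi b'pi; rewrite !ltr_norml => /andP[? ?] /andP[? ?]; lra.
  by rewrite -opprB mulNr sinN s0 oppr0 ltxx.
have : 0 < sin ((b - b') / 2).
  apply: sin_gt0_pi; rewrite ?divr_gt0 ?subr_gt0//.
  by move: bpi b'pi; rewrite !ltr_norml => /andP[? ?] /andP[? ?]; lra.
by rewrite s0 ltxx.
Qed.

Section power_series.
Variable z : R[i].

(* [w] makes the family stable under differentiation: (f w)' = f (w * z). Real
   and imaginary parts are the cases [w = 1] and, up to sign, [w = 'i]. *)
Let coef w : R^nat := fun m => Re (w * z ^+ m) / m`!%:R.

Let cvg_coef w x : cvgn (pseries (coef w) x).
Proof.
pose N u := `|Re u| + `|Im u|.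
have NM u v : N (u * v) <= N u * N v.
  rewrite /N ReM ImM mulrDl !mulrDr -!normrM.
  have := ler_normB (Re u * Re v) (Im u * Im v).
  have := ler_normD (Re u * Im v) (Im u * Re v); lra.
have NX m : N (w * z ^+ m) <= N w * N z ^+ m.
  elim: m => [|m IH]; first by rewrite !expr0 !mulr1.
  by rewrite exprSr mulrA (le_trans (NM _ _))// exprSr mulrA ler_wpM2r// addr_ge0.
apply: normed_cvg.
apply: (@series_le_cvg _ _ (N w *: exp_coeff (N z * `|x|))).
- by move=> m; exact: normr_ge0.
- by move=> m; apply: mulr_ge0; [exact: addr_ge0|apply: exp_coeff_ge0; rewrite mulr_ge0// addr_ge0].
- move=> m; rewrite /= /coef 2!normrM normrX [`|_^-1|]ger0_norm ?invr_ge0//.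
  rewrite -[leRHS]/(N w * ((N z * `|x|) ^+ m / m`!%:R)) exprMn 2!mulrA [leLHS]mulrAC.
  rewrite ler_wpM2r ?invr_ge0// ler_wpM2r ?exprn_ge0//.
  by rewrite (le_trans _ (NX m))// lerDl.
- by apply: is_cvg_seriesZ; exact: is_cvg_series_exp_coeff.
Qed.

Let f w x := limn (pseries (coef w) x).

Let f_derive w x : is_derive x (1 : R) (f w) (f (w * z) x).
Proof.
have dE v : pseries_diffs (coef v) = coef (v * z).
  apply/funext => m; rewrite /pseries_diffs /coef exprS mulrA factS natrM.
  by rewrite invfM mulrACA mulfV ?mul1r ?mulrA// pnatr_eq0.
rewrite /f -dE; apply: (@pseries_snd_diffs _ _ (`|x| + 1)).
- exact: cvg_coef.
- by rewrite dE; exact: cvg_coef.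
- by rewrite !dE; exact: cvg_coef.
- by rewrite [ltRHS]ger0_norm ?addr_ge0// ltrDl.
Qed.

Let f_lin (k l : R) u v w x : (forall y, Re (w * y) = k * Re (u * y) + l * Re (v * y)) ->
  f w x = k * f u x + l * f v x.
Proof.
move=> H; apply: cvg_lim => //.
rewrite (_ : pseries (coef w) x = k *: pseries (coef u) x + l *: pseries (coef v) x).
  by apply: cvgD; apply: cvgZl_tmp; exact: cvg_coef.
apply/funext => n; rewrite /pseries /series/= !fctE.
rewrite !scaler_sumr -big_split/=; apply: eq_bigr => m _.
by rewrite /coef H /GRing.scale/=; ring.
Qed.

Let f0 w : f w 0 = Re w.
Proof.
apply: cvg_lim => //; rewrite -cvg_shiftS; apply: cvg_near_cst; apply: nearW => n.
rewrite /pseries /series/= big_nat_recl// big1 => [|m _]; last by rewrite expr0n mulr0.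
by rewrite /coef !expr0 fact0 !mulr1 invr1 mulr1 addr0.
Qed.

Let a := Re z.
Let b := Im z.
Let i : R[i] := Complex 0 1.

Let f_cexp : f 1 1 = Re (cexp z) /\ f i 1 = - Im (cexp z).
Proof.
have d1 x : is_derive x (1 : R) (f 1) (a * f 1 x + b * f i x).
  have := f_derive 1 x; rewrite (@f_lin a b 1 i)// => y.
  by rewrite mul1r mul1r !ReM/=; rewrite /a /b; ring.
have di x : is_derive x (1 : R) (f i) (a * f i x + - b * f 1 x).
  have := f_derive i x; rewrite (@f_lin a (- b) i 1)// => y.
  by rewrite mul1r !ReM !ImM/= /a /b; ring.
(* [p] and [- q] are the real and imaginary parts of [e^(- z x) (f 1 x - i * f i x)], which is
   constant because the second factor solves [u' = z u]. *)
pose e x : R := expR (- a * x).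
pose p x := e x * (f 1 x * cos (b * x) - f i x * sin (b * x)).
pose q x := e x * (f i x * cos (b * x) + f 1 x * sin (b * x)).
have pE : p 1 = p 0.
  apply: is_derive_0_is_cst => x; rewrite /p /e.
  by apply: is_derive_eq; rewrite /GRing.scale/=; ring.
have qE : q 1 = q 0.
  apply: is_derive_0_is_cst => x; rewrite /q /e.
  by apply: is_derive_eq; rewrite /GRing.scale/=; ring.
move: pE qE; rewrite /p /q /e !mulr1 !mulr0 expR0 cos0 sin0 !f0 !mul1r !mulr0 !mulr1.
rewrite subr0 addr0 [X in _ -> _ = X -> _]/=.
set X := f 1 1; set Y := f i 1 => pE qE.
have c2 := cos2Dsin2 b; have ee := expRxMexpNx_1 a.
have {}pE : X * cos b - Y * sin b = expR a.
  by rewrite -[RHS]mulr1 -[in RHS](pE) mulrA ee mul1r.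
have {}qE : Y * cos b + X * sin b = 0.
  by apply: (mulfI (lt0r_neq0 (expR_gt0 (- a)))); rewrite mulr0 qE.
rewrite /cexp /= -/a -/b -pE; split.
  by rewrite -[LHS]mulr1 -c2 -[RHS]addr0 -(mul0r (sin b)) -qE; ring.
by rewrite -[LHS]mulr1 -c2 -[RHS]addr0 -(mul0r (cos b)) -qE; ring.
Qed.

Lemma cvg_cexp :
  (fun n => Re (\sum_(0 <= m < n) (m`!%:R^-1)%:C%C * z ^+ m)) @ \oo --> Re (cexp z) /\
  (fun n => Im (\sum_(0 <= m < n) (m`!%:R^-1)%:C%C * z ^+ m)) @ \oo --> Im (cexp z).
Proof.
have [<- fi] := f_cexp; split.
  rewrite (_ : (fun n => _) = pseries (coef 1) 1); first exact: cvg_coef.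
  apply/funext => n; rewrite Re_sum; apply: eq_bigr => m _ /=.
  by rewrite ReM/= mul0r subr0 /coef mul1r expr1n mulr1 mulrC.
rewrite -[Im (cexp z)]opprK -fi.
have fN : (fun n => - pseries (coef i) 1 n) @ \oo --> - f i 1.
  by apply: cvgN; exact: cvg_coef.
apply: (cvg_trans _ fN); apply: near_eq_cvg; apply: nearW => n.
rewrite Im_sum -sumrN; apply: eq_bigr => m _ /=.
by rewrite ImM/= mul0r addr0 /coef expr1n mulr1 ReM/= mul0r mul1r sub0r mulNr opprK mulrC.
Qed.

End power_series.

End complex_exponential.

Section common_eigenvector.
Context {C : numClosedFieldType} {n : nat}.

(** Since [W] commutes with [A] and [B], its row space is stable under both. The restrictions to it
    commute, so they share an eigenvector, which has the form [u *m W] because it lies in the row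
    space. *)
Lemma image_common_eigenvector (W A B : 'M[C]_n) : W != 0 ->
  W *m A = A *m W -> W *m B = B *m W -> A *m B = B *m A ->
  exists u : 'rV_n, exists a b,
    [/\ u *m W != 0, u *m W *m A = a *: (u *m W) & u *m W *m B = b *: (u *m W)].
Proof.
move=> W0 WA WB AB.
have sA : stablemx W A by rewrite WA submxMl.
have sB : stablemx W B by rewrite WB submxMl.
have [||v v0 /andP[vA vB]] := @common_eigenvector2 _ _ (restrictmx W A) (restrictmx W B).
- by rewrite lt0n mxrank_eq0.
- by rewrite -!conjmxM ?inE ?stablemx_row_base// AB.
have /submxP[u uE] : (v *m row_base W <= W)%MS by rewrite mulmx_sub// eq_row_base.
rewrite !stablemx_restrict// in vA vB.
have /sub_rVP[a aE] := vA; have /sub_rVP[b bE] := vB.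
exists u, a, b; rewrite -uE; split => //.
by rewrite mulmx_free_eq0// row_base_free.
Qed.

End common_eigenvector.

Section uniqueness.
Context {R : realType} {K : nat}.
Local Notation Re := (@complex.Re R).
Local Notation Im := (@complex.Im R).
Local Notation toC := (map_mx (real_complex R)).
Implicit Types (B L S : 'M[R]_K) (u v : 'rV[R[i]]_K).

(** Separate vectors [u] and [v] serve two uses: [u = v] for eigenvectors of the exponential, and
    [v = u (B - L)] in the uniqueness argument. *)
Lemma mulmx_lim_eigen (S : nat -> 'M[R]_K) T (s : nat -> R[i]) z u v :
  S @ \oo --> T -> (fun n => Re (s n)) @ \oo --> Re z -> (fun n => Im (s n)) @ \oo --> Im z ->
  (forall n, u *m toC (S n) = s n *: v) -> u *m toC T = z *: v.
Proof.
move=> /cvg_mxP ST sRe sIm uS; apply/rowP => j.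
have H n : \sum_i u 0 i * (S n i j)%:C%C = s n * v 0 j.
  have /rowP/(_ j) := uS n; rewrite !mxE => <-.
  by apply: eq_bigr => i _; rewrite mxE.
rewrite !mxE; under eq_bigr do rewrite mxE.
apply/eqP; rewrite eq_complex; apply/andP; split; apply/eqP.
  have h1 : (fun n => Re (s n * v 0 j)) @ \oo --> Re (\sum_i u 0 i * (T i j)%:C%C).
    rewrite Re_sum; under eq_fun do rewrite -H Re_sum.
    apply: cvg_big => [|i _]; first exact: add_continuous.
    rewrite ReM/= mulr0 subr0; under eq_fun do rewrite ReM/= mulr0 subr0.
    by apply: cvgM; [exact: cvg_cst|exact: ST].
  have h2 : (fun n => Re (s n * v 0 j)) @ \oo --> Re (z * v 0 j).
    rewrite ReM; under eq_fun do rewrite ReM.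
    by apply: cvgB; apply: cvgM => //; exact: cvg_cst.
  exact: cvg_unique h1 h2.
have h1 : (fun n => Im (s n * v 0 j)) @ \oo --> Im (\sum_i u 0 i * (T i j)%:C%C).
  rewrite Im_sum; under eq_fun do rewrite -H Im_sum.
  apply: cvg_big => [|i _]; first exact: add_continuous.
  rewrite ImM/= mulr0 add0r; under eq_fun do rewrite ImM/= mulr0 add0r.
  by apply: cvgM; [exact: cvg_cst|exact: ST].
have h2 : (fun n => Im (s n * v 0 j)) @ \oo --> Im (z * v 0 j).
  rewrite ImM; under eq_fun do rewrite ImM.
  by apply: cvgD; apply: cvgM => //; exact: cvg_cst.
exact: cvg_unique h1 h2.
Qed.

Lemma eigen_exp B v z m : v *m toC B = z *: v -> v *m toC (B ^+ m) = z ^+ m *: v.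
Proof.
move=> vB; elim: m => [|m IH]; first by rewrite !expr0 map_mx1 mulmx1 scale1r.
by rewrite exprSr map_mxM mulmxA IH -scalemxAl vB scalerA exprSr.
Qed.

Lemma eigen_mexp B v z : v *m toC B = z *: v -> v *m toC (mexp B) = cexp z *: v.
Proof.
move=> vB; have [zR zI] := cvg_cexp z.
apply: (mulmx_lim_eigen (@cvg_mexp _ _ B) zR zI) => n.
rewrite /series/= raddf_sum mulmx_sumr scaler_suml; apply: eq_bigr => m _.
by rewrite /mexp_term /= map_mxZ -scalemxAr (eigen_exp _ vB) scalerA.
Qed.

(* Otherwise the image of D = B - L contains a common eigenvector v = u D of B and
   L. Its two eigenvalues have the same exponential, hence both equal some b, so
   that u (B^(m+1) - L^(m+1)) = (m+1) b^m v; summing the exponential series gives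
   0 = u (mexp B - mexp L) = cexp b v. *)
Lemma mexp_inj_strip B L : B *m L = L *m B -> mexp B = mexp L ->
  (forall z, eigenvalue (toC B) z -> `|Im z| < pi) ->
  (forall z, eigenvalue (toC L) z -> `|Im z| < pi) -> B = L.
Proof.
move=> BL eBL sB sL; apply/eqP/negPn/negP => BL0.
pose D := B - L.
have DC0 : toC D != 0 by rewrite map_mx_eq0 subr_eq0.
have DB : D *m B = B *m D by rewrite /D mulmxBl mulmxBr BL.
have DL : D *m L = L *m D by rewrite /D mulmxBl mulmxBr BL.
have [||||u [b [l [v0 vB vL]]]] := @image_common_eigenvector _ _ (toC D) (toC B) (toC L).
- by [].
- by rewrite -!map_mxM DB.
- by rewrite -!map_mxM DL.
- by rewrite -!map_mxM BL.
set v := u *m toC D in v0 vB vL.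
have bl : b = l.
  apply: cexp_inj.
  - by apply: sB; apply/eigenvalueP; exists v.
  - by apply: sL; apply/eigenvalueP; exists v.
  - apply/eqP; rewrite -subr_eq0 -[_ == 0]orbF -(negbTE v0) -scaler_eq0 scalerBl.
    by rewrite -(eigen_mexp vB) -(eigen_mexp vL) eBL subrr.
rewrite -bl in vL.
(* The difference of powers factors with [B - L] on the left, which turns [u] into [v]; each of the
   [m + 1] remaining products acts on [v] as [b^m]. *)
have uX m : u *m toC (B ^+ m.+1 - L ^+ m.+1) = (m.+1%:R * b ^+ m) *: v.
  rewrite subrXX_comm// map_mxM mulmxA -/v raddf_sum mulmx_sumr/=.
  rewrite (eq_bigr (fun=> b ^+ m *: v)) => [|i _].
    by rewrite sumr_const card_ord scalerMnl mulr_natl.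
  rewrite map_mxM mulmxA (eigen_exp _ vB) -scalemxAl (eigen_exp _ vL) scalerA -exprD subnK//.
  by rewrite -ltnS.
(* One more term than in the series of [cexp b]: the constant terms cancel, and
   [(m+1) / (m+1)! = 1 / m!]. *)
pose S n := series (mexp_term B) n.+1 - series (mexp_term L) n.+1.
have S0 : S @ \oo --> (0 : 'M[R]_K).
  rewrite -(subrr (mexp B)) {2}eBL.
  apply: (@cvgB _ _ _ \oo _ (fun n => series (mexp_term B) n.+1) (fun n => series (mexp_term L) n.+1)).
    by rewrite (cvg_shiftS (series (mexp_term B))); exact: cvg_mexp.
  by rewrite (cvg_shiftS (series (mexp_term L))); exact: cvg_mexp.
have [zR zI] := cvg_cexp b.
suff uS n : u *m toC (S n) = (\sum_(0 <= m < n) (m`!%:R^-1)%:C%C * b ^+ m) *: v.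
  have /eqP := mulmx_lim_eigen S0 zR zI uS.
  by rewrite map_mx0 mulmx0 eq_sym scaler_eq0 (negbTE (cexp_neq0 b)) (negbTE v0).
rewrite /S /series/= !big_nat_recl// {1 3}/mexp_term !expr0 opprD addrACA subrr add0r.
rewrite -sumrB raddf_sum mulmx_sumr scaler_suml; apply: eq_bigr => m _.
rewrite /mexp_term -scalerBr /= map_mxZ -scalemxAr uX scalerA; congr (_ *: _).
rewrite mulrA; congr (_ * _).
rewrite -(rmorph_nat (real_complex R)) -rmorphM/= factS natrM invfM mulrAC.
by rewrite mulVf ?mul1r// pnatr_eq0.
Qed.

Lemma eigenvalue_norm_le L z : eigenvalue (toC L) z -> `|Im z| <= K%:R * `|L|.
Proof.
move=> /eigenvalueP[v vL v0].
pose s := \sum_i `|v 0 i|.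
have s0 : 0 < s.
  rewrite lt0r sumr_ge0// andbT psumr_eq0//; apply: contra v0 => /allP v0.
  apply/eqP/rowP => i; rewrite mxE; apply/eqP; rewrite -normr_eq0.
  by apply: v0; rewrite mem_index_enum.
have : `|z| * s <= (K%:R * `|L|)%:C%C * s.
  rewrite [in leLHS]/s mulr_sumr.
  apply: (@le_trans _ _ (\sum_i \sum_k `|v 0 k| * (`|L|)%:C%C)).
    apply: ler_sum => i _; rewrite -normrM.
    have /rowP/(_ i) := vL; rewrite !mxE => <-.
    rewrite (le_trans (ler_norm_sum _ _ _))//; apply: ler_sum => k _.
    rewrite normrM ler_wpM2l// !mxE normc_def/= expr0n/= addr0 sqrtr_sqr.
    by rewrite lecR; exact: mx_norm_ge.
  by rewrite sumr_const card_ord -mulr_suml rmorphM/= rmorph_nat -mulrA mulr_natl mulrC.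
rewrite ler_pM2r// normc_def lecR; apply: le_trans.
by rewrite -sqrtr_sqr ler_wsqrtr// lerDr sqr_ge0.
Qed.

Lemma mlog_near1 : exists2 e : R, 0 < e & forall A : 'M[R]_K, `|A - 1| <= e ->
  has_mlog A /\ `|mlog A - (A - 1)| <= 8 * K.+1%:R ^+ 2 * `|A - 1| ^+ 2.
Proof.
have c0 : 0 < 8 * K.+1%:R ^+ 2 :> R by rewrite mulr_gt0// exprn_gt0.
have [e e0 [e1 e2]] : exists2 e : R, 0 < e &
    e <= (8 * K.+1%:R ^+ 2)^-1 /\ K%:R * (2 * e) < pi.
  (* The first bound is that of [mexp_near1]. The second confines the eigenvalues of a matrix of
     norm at most [2 e] to [|Im z| <= K / (K + 1) < pi]. *)
  exists (Num.min (8 * K.+1%:R ^+ 2)^-1 (2^-1 * K.+1%:R^-1)).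
    by rewrite lt_min !invr_gt0 c0 mulr_gt0 ?invr_gt0.
  split; first by rewrite ge_min lexx.
  rewrite (@le_lt_trans _ _ (K%:R * (2 * (2^-1 * K.+1%:R^-1))))//.
    by rewrite ler_wpM2l// ler_wpM2l// ge_min lexx orbT.
  rewrite mulrA mulrA mulfK// ?mulrA.
  rewrite (@le_lt_trans _ _ 1)//.
    by rewrite ler_pdivrMr// mul1r ler_nat.
  by have := @pi_ge2 R; lra.
exists e => // A Ae.
have [L [LA Le Lr LC]] := mexp_near1 (le_trans Ae e1).
have Ls z : eigenvalue (toC L) z -> `|Im z| < pi.
  move=> /eigenvalue_norm_le /le_lt_trans; apply; apply: le_lt_trans e2.
  by rewrite ler_wpM2l// (le_trans Le)// ler_wpM2l.
have Llog : is_mlog A L by split.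
have has : has_mlog A by exists L.
split => //; suff -> : mlog A = L by [].
have [BA Bs] : is_mlog A (mlog A) := getPex has.
apply: mexp_inj_strip => //; last by rewrite BA LA.
(* [mlog A] commutes with its exponential [A], hence with [L], which commutes with the commutant of
   [A]. *)
by apply/esym/LC; rewrite -{1}BA comm_mexp// BA.
Qed.

End uniqueness.

(** * Nondegeneracy of the random sample *)

Section independence.
Context d (Omega : measurableType d) (R : realType) (P : probability Omega R).
Context (n : nat) (x : nat -> {RV P >-> borel_rV R n}).

(* A pi-system generating the sigma-algebra [past K] of x 0, ..., x (K - 1). *)
Definition past_cylinder (K : nat) : set (set Omega) :=
  [set E | exists A : nat -> set (borel_rV R n), (forall k, measurable (A k)) /\
    E = \bigcap_(k in [set` iota 0 K]) x k @^-1` A k].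

Definition past K := g_sigma_algebraType (past_cylinder K).

HB.instance Definition _ K := Measurable.on (past K).

Lemma past_sub K (E : set (past K)) : measurable E -> measurable (E : set Omega).
Proof.
apply: smallest_sub; first exact: sigma_algebra_measurable.
move=> _ [A [mA ->]]; apply: fin_bigcap_measurable => // k _.
by rewrite -[X in measurable X]setTI; exact: measurable_funPT.
Qed.

Lemma measurable_fun_past K k : (k < K)%N ->
  measurable_fun setT (x k : past K -> borel_rV R n).
Proof.
move=> kK _ B mB; rewrite setTI; apply: sub_sigma_algebra.
exists (fun i => if i == k then B else setT); split; first by move=> i; case: ifP.
apply/seteqP; split => [w xw i _|w]; first by case: eqP => [->|].
by move=> /(_ k); rewrite eqxx; apply; rewrite /= mem_iota.
Qed.

(** Dynkin induction on [E]: on cylinders this is the independence of [x 0], ..., [x K], and the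
    formula passes to complements and to disjoint countable unions. *)
Lemma past_independent K (E : set (past K)) (B : set (borel_rV R n)) :
  mutually_independent x -> measurable E -> measurable B ->
  P (E `&` x K @^-1` B) = (P E * P (x K @^-1` B))%E.
Proof.
move=> ind mE mB; set C := x K @^-1` B.
have mC : measurable (C : set Omega).
  by rewrite -[X in measurable X]setTI; exact: measurable_funPT.
have PC : P C \is a fin_num by exact: fin_num_measure.
move: E mE; apply: dynkin_induction => //=.
- move=> _ _ [A [mA ->]] [A' [mA' ->]].
  exists (fun k => A k `&` A' k); split; first by move=> k; exact: measurableI.
  apply/seteqP; split => [w [h h'] k kK|w h]; first by split; [exact: h|exact: h'].
  by split => k /h [].
- by rewrite setTI probability_setT mul1e.
- move=> _ [A [mA ->]].
  pose A' k := if (k < K)%N then A k else B.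
  have mA' k : measurable (A' k) by rewrite /A'; case: ifP.
  have A'K : A' K = B by rewrite /A' ltnn.
  have := ind (iota 0 K) _ (iota_uniq _ _) mA; have := ind (iota 0 K.+1) _ (iota_uniq _ _) mA'.
  rewrite -[K.+1]addn1 iotaD add0n big_cat/= big_seq1 A'K -/C => h1 ->.
  have -> : (\prod_(k <- iota 0 K) P (x k @^-1` A k) = \prod_(k <- iota 0 K) P (x k @^-1` A' k))%E.
    by apply: eq_big_seq => k; rewrite mem_iota /= /A' => ->.
  rewrite -h1; congr (P _); apply/seteqP; split => [w [h Cw] k /=|w h].
    rewrite mem_cat mem_iota/= inE => /orP[kK|/eqP ->]; last by rewrite A'K.
    by rewrite /A' kK; apply: h; rewrite /= mem_iota.
  split => [k /=|].
    rewrite mem_iota/= => kK; have := h k; rewrite /A' kK; apply.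
    by rewrite /= mem_cat mem_iota/= kK.
  by have := h K; rewrite A'K; apply; rewrite /= mem_cat inE eqxx orbT.
- move=> S /past_sub mS SE.
  have -> : ~` S `&` C = C `\` (S `&` C) by rewrite setDIr setDv setU0 setIC setDE.
  rewrite measureD//; last 2 first.
  - exact: measurableI.
  - by rewrite ltey_eq PC.
  transitivity (P C - P S * P C)%E.
    by congr (_ - _)%E; rewrite -SE; congr (P _); rewrite setICA setIid.
  rewrite probability_setC// muleBl ?mul1e//.
- move=> F mF tF FE.
  have mF' k : measurable (F k : set Omega) by exact: past_sub.
  rewrite setI_bigcupl measure_semi_bigcup; last 3 first.
  - by move=> k; exact: measurableI.
  - exact: trivIset_setIr.
  - by apply: bigcup_measurable => k _; exact: measurableI.
  rewrite measure_semi_bigcup//; last exact: bigcup_measurable.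
  rewrite (eq_eseriesr (fun k _ => FE k)) muleC -(fineK PC) -nneseriesZl//.
  by apply: eq_eseriesr => k _; rewrite muleC.
Qed.

(** By [past_independent] the joint law of [c] and [x K] agrees on rectangles with the product of
    their laws, hence everywhere; the product law integrates the measures of the sections of [S],
    all zero. *)
Lemma past_section_null K m (c : past K -> borel_rV R m)
    (S : set (borel_rV R m * borel_rV R n)) :
  mutually_independent x -> measurable_fun setT c -> measurable S ->
  (forall a, distribution P (x K) (xsection S a) = 0%E) ->
  P.-negligible [set w | S (c w, x K w)].
Proof.
move=> ind mc mS S0.
have mc' : measurable_fun setT (c : Omega -> borel_rV R m).
  by move=> _ B mB; rewrite setTI; apply: past_sub; rewrite -[X in measurable X]setTI; exact: mc.
pose h w := (c w, x K w).
have mh : measurable_fun setT (h : Omega -> _).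
  by apply/measurable_fun_pairP; split => //; exact: measurable_funPT.
pose cc : {RV P >-> borel_rV R m} := mfun_Sub (mem_set mc').
pose hh : {RV P >-> (borel_rV R m * borel_rV R n)%type} := mfun_Sub (mem_set mh).
apply/negligibleP.
  by rewrite -[X in measurable X](setTI (h @^-1` S)); exact: (mh measurableT S mS).
have := @product_measure_unique _ _ _ _ R (distribution P cc) (distribution P (x K))
  (distribution P hh) _ S mS.
have -> : (distribution P cc \x distribution P (x K))%E S = 0%E.
  by rewrite /= /product_measure1; apply: integral0_eq => a _; exact: S0.
move=> H; apply/esym; apply: H => A B mA mB.
rewrite /distribution /pushforward /=.
transitivity (P ((c @^-1` A) `&` (x K @^-1` B))) => //.
rewrite past_independent//.
by rewrite -[X in measurable X]setTI; exact: mc.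
Qed.


End independence.

Lemma measurable_det d (T : measurableType d) (R : realType) m (M : T -> 'M[R]_m) :
  (forall i j, measurable_fun setT (fun t => M t i j)) ->
  measurable_fun setT (fun t => \det (M t)).
Proof.
move=> mM; apply: measurable_sum => s; apply: measurable_funM => //.
by apply: measurable_prod => i _; exact: mM.
Qed.

Section nondegenerate_sampling.
Context d (Omega : measurableType d) (R : realType) (P : probability Omega R).
Context (n : nat) (x : nat -> {RV P >-> borel_rV R n}) (X : set 'rV[R]_n).
Context (g : nat -> 'rV[R]_n -> R).
Hypotheses (X_compact : compact X) (x_independent : mutually_independent x)
  (x_uniform : forall k, uniform_on X (x k)) (g_C1 : forall l, C1_near X (g l))
  (g_nondegenerate : basis_nondegenerate X g).

Let mX : measurable (X : set (borel_rV R n)).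
Proof.
rewrite -[X]setCK; apply: measurableC; apply: sub_sigma_algebra.
by apply: closed_openC; apply: compact_closed => //; exact: norm_hausdorff.
Qed.

(* The [g l] are only controlled near X; their restrictions are Borel everywhere. *)
Let gX l : borel_rV R n -> R := (g l : borel_rV R n -> R) \_ X.

Let measurable_gX l : measurable_fun setT (gX l).
Proof.
apply/(@measurable_restrictT _ _ (borel_rV R n) (measurableTypeR R) X (g l) mX).
have [U [oU XU gU]] := g_C1 l.
apply: (@measurability _ _ _ _ _ _ _ (RGenOpens.measurableE R)) => //.
move=> _ [_ [a [b ->] <-]].
rewrite (_ : X `&` _ = X `&` (U `&` g l @^-1` `]a, b[%classic)); last first.
  by rewrite setIA (setIidl XU).
apply: measurableI => //; apply: sub_sigma_algebra.
rewrite openE => z [Uz gz]; rewrite /interior; apply: filterI.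
  exact: open_nbhs_nbhs.
have [gd _] := gU z Uz.
apply: (differentiable_continuous gd).
by apply: open_nbhs_nbhs; split => //; exact: interval_open.
Qed.

Let X_ae k : {ae P, forall w, X (x k w)}.
Proof.
exists (x k @^-1` ~` X); split => //.
  by rewrite -[Y in measurable Y]setTI; apply: measurable_funPT => //; exact: measurableC.
transitivity (distribution P (x k) (~` X)) => //.
by rewrite x_uniform ?setICl ?measure0 ?mul0e//; exact: measurableC.
Qed.

Let DX K (w : Omega) : 'M[R]_K := \matrix_(k, l) gX l (x k w).

(* Expansion along the last row: the determinant of order K + 1 is a combination of
   the g l (x K) with coefficients depending on x 0, ..., x (K - 1) only, and the
   coefficient of g K is the determinant of order K. *)
Let det_step K : P.-negligible
  [set w | [/\ X (x K w), \det (DX K w) != 0 & \det (DX K.+1 w) = 0]].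
Proof.
(* The cofactors of the last row omit the sample point [x K], so [c] is measurable with respect to
   the past. *)
pose c (w : past x K) : borel_rV R K.+1 := \row_l cofactor (DX K.+1 w) ord_max l.
have mc : measurable_fun setT c.
  apply: measurable_rVP => l.
  rewrite (_ : (fun _ => _) = (fun w => cofactor (DX K.+1 w) ord_max l)); last first.
    by apply/funext => w; rewrite mxE.
  apply: measurable_funM => //; apply: measurable_det => i j.
  rewrite (_ : (fun _ => _) = gX (lift l j) \o (x (lift ord_max i) : past x K -> borel_rV R n)).
    apply: measurableT_comp => //; apply: measurable_fun_past.
    by rewrite lift_max.
  by apply/funext => w; rewrite !mxE.
pose comb (p : borel_rV R K.+1 * borel_rV R n) := \sum_(l < K.+1) (p.1 : 'rV[R]_K.+1) 0 l * gX l p.2.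
pose S := [set p : borel_rV R K.+1 * borel_rV R n |
  [/\ X p.2, (p.1 : 'rV[R]_K.+1) 0 ord_max != 0 & comb p = 0]].
have mS : measurable S.
  have m1 l : measurable_fun setT (fun p : borel_rV R K.+1 * borel_rV R n => (p.1 : 'rV[R]_K.+1) 0 l).
    rewrite (_ : (fun _ => _) = (fun v : borel_rV R K.+1 => (v : 'rV[R]_K.+1) 0 l) \o fst)//.
    by apply: measurableT_comp; [exact: measurable_coord|exact: measurable_fst].
  have mcomb : measurable_fun setT comb.
    apply: measurable_sum => l; apply: measurable_funM => //.
    exact: measurableT_comp.
  rewrite (_ : S = snd @^-1` X `&` ((fun p => (p.1 : 'rV[R]_K.+1) 0 ord_max) @^-1` [set~ 0] `&`
      comb @^-1` [set 0])); last first.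
    apply/seteqP; split => [p [? /eqP ? ?]|p [? [/eqP ? ?]]]; split => //.
  apply: measurableI; last apply: measurableI.
  - by rewrite -[Y in measurable Y]setTI; apply: measurable_snd.
  - by rewrite -[Y in measurable Y]setTI; apply: m1 => //; exact: measurableC.
  - by rewrite -[Y in measurable Y]setTI; exact: mcomb.
have S0 a : distribution P (x K) (xsection S a) = 0%E.
  rewrite x_uniform; last exact: measurable_xsection.
  rewrite (_ : lebesgue_rV n _ = 0%E) ?mul0e//.
  have [a0|a0] := eqVneq ((a : 'rV[R]_K.+1) 0 ord_max) 0.
    rewrite (_ : _ `&` _ = set0) ?measure0// -subset0 => z [].
    by rewrite /xsection/= inE /S/= a0 eqxx => -[].
  (* The finite coefficient row is extended by zeros, so that the partial sums in the nondegeneracy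
     hypothesis are constant from [K + 1] terms on. *)
  pose c' l := if insub l is Some i then (a : 'rV[R]_K.+1) 0 i else 0.
  have c'E (i : 'I_K.+1) : c' i = (a : 'rV[R]_K.+1) 0 i by rewrite /c' valK.
  rewrite -(g_nondegenerate (c := c')); last by exists K; rewrite (c'E ord_max).
  have sE z m : X z -> series (fun l => c' l * g l z) (m + K.+1)%N = comb (a, z).
    move=> Xz; rewrite /series/= addnC big_mkord big_split_ord/= [X in _ + X]big1.
      rewrite addr0; apply: eq_bigr => l _; rewrite c'E /gX patchE mem_set//.
    by move=> i _; rewrite /c' insubF ?mul0r// ltnNge leq_addr.
  congr (lebesgue_rV n _); apply/seteqP; split => z.
    move=> [+ Xz]; rewrite /xsection/= inE => -[_ _ c0]; split => //.
    rewrite -(cvg_shiftn K.+1); apply: cvg_near_cst; apply: nearW => m /=.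
    by rewrite sE.
  move=> [Xz]; rewrite -(cvg_shiftn K.+1) => h; split => //.
  rewrite /xsection/= inE; split => //.
  apply: (cvg_unique _ _ h) => //; apply: cvg_near_cst; apply: nearW => m /=.
  by rewrite sE.
apply: negligibleS (past_section_null x_independent mc mS S0) => w /= [Xw dK dK1].
split => //=.
  rewrite /c mxE /cofactor/= -signr_odd addnn odd_double mul1r.
  have -> : row' ord_max (col' ord_max (DX K.+1 w)) = DX K w; last by [].
  by apply/matrixP => i l; rewrite !mxE !lift_max.
rewrite -dK1 (expand_det_row _ ord_max); apply: eq_bigr => l _.
by rewrite /c !mxE mulrC.
Qed.

(** The null sets of [det_step] are discarded for all [K] at once; induction on [K] starts from the
    empty determinant, equal to 1. *)
Lemma det_data_mx_ae : {ae P, forall w, (forall k, X (x k w)) /\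
  forall K, \det (data_mx g K K (fun k => x k w)) != 0}.
Proof.
have XP := ae_foralln X_ae.
have DP : {ae P, forall w, forall K, X (x K w) -> \det (DX K w) != 0 -> \det (DX K.+1 w) != 0}.
  apply: ae_foralln => K; apply: negligibleS (det_step K) => w /= h.
  by move: h => /not_implyP[Xw /not_implyP[dK /negP/negPn/eqP dK1]].
apply: filterS2 XP DP => w Xw Dw; split => // K.
have <- : DX K w = data_mx g K K (fun k => x k w).
  by apply/matrixP => k l; rewrite !mxE /gX patchE mem_set.
by elim: K => [|K IH]; [rewrite det_mx00 oner_eq0|exact: Dw].
Qed.

End nondegenerate_sampling.

(** * Differentiation of the logarithm and along the flow *)

Section logarithm_limit.
Context {R : realType} {K : nat}.

(** [A t - 1] is [t] times a convergent quotient, so it tends to 0. By the quadratic bound, the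
    error of [mlog (A t)] divided by [t] is at most [c |A t - 1|] times the norm of that quotient,
    and vanishes in the limit. *)
Lemma mlog_cvg (A : R -> 'M[R]_K) (G : 'M[R]_K) :
  (fun t => t^-1 *: (A t - 1)) @ 0^'+ --> G ->
  (\forall t \near 0^'+, has_mlog (A t)) /\
  (fun t => t^-1 *: mlog (A t)) @ 0^'+ --> G.
Proof.
move=> AG; have [e e0 mlogA] := @mlog_near1 R K.
have A1 : (fun t => A t - 1) @ 0^'+ --> (0 : 'M[R]_K).
  rewrite -(scale0r G).
  have : (fun t : R => t *: (t^-1 *: (A t - 1))) @ 0^'+ --> 0 *: G.
    by apply: cvgZ AG; apply: cvg_at_right_filter; exact: cvg_id.
  apply: cvg_trans; apply: near_eq_cvg; near=> t.
  by rewrite scalerA mulfV ?scale1r// gt_eqF//.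
have nA1 : \forall t \near 0^'+, `|A t - 1| <= e.
  by have /cvgr0Pnorm_le := A1; apply.
split; first by apply: filterS nA1 => t /mlogA[].
set c := 8 * K.+1%:R ^+ 2 : R in mlogA.
have c0 : 0 <= c by rewrite mulr_ge0// exprn_ge0.
rewrite -[G]addr0.
have r0 : (fun t => t^-1 *: (mlog (A t) - (A t - 1))) @ 0^'+ --> (0 : 'M[R]_K).
  apply/cvgr0Pnorm_le => d d0.
  have : (fun t => c * `|A t - 1| * `|t^-1 *: (A t - 1)|) @ 0^'+ --> c * `|0 : 'M[R]_K| * `|G|.
    apply: cvgM; last exact: cvg_norm.
    by apply: cvgM; [exact: cvg_cst|exact: cvg_norm].
  rewrite normr0 mulr0 mul0r => /cvgr0Pnorm_le/(_ d d0) H.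
  near=> t; have At : `|A t - 1| <= e by near: t.
  have Ht : `|c * `|A t - 1| * `|t^-1 *: (A t - 1)| | <= d by near: t.
  apply: le_trans Ht; rewrite [leRHS]ger0_norm ?mulr_ge0//.
  rewrite !normrZ mulrCA ler_wpM2l// -mulrA -expr2.
  by have [] := mlogA _ At.
apply: (cvg_trans _ (cvgD AG r0)); apply: near_eq_cvg; apply: nearW => t.
by rewrite fctE -scalerDr addrC subrK.
Unshelve. all: by end_near. Qed.

End logarithm_limit.

Section flow.
Context {R : realType} {n : nat}.
Context (F : 'rV[R]_n -> 'rV[R]_n) (phi : R -> 'rV[R]_n -> 'rV[R]_n).
Implicit Types (f h : 'rV[R]_n -> R) (z : 'rV[R]_n).

Lemma koopman_genE f z : differentiable f z -> koopman_gen F f z = 'D_(F z) f z.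
Proof.
move=> fz; rewrite deriveE// [in RHS](row_sum_delta (F z)) linear_sum.
by apply: eq_bigr => i _; rewrite linearZ deriveE.
Qed.

Lemma is_derive_cvg_right (W : normedModType R) (c : R -> W) v :
  is_derive (0 : R) (1 : R) c v -> (fun t => t^-1 *: (c t - c 0)) @ 0^'+ --> v.
Proof.
move=> [dc <-]; apply: cvg_dnbhs_at_right; apply: cvg_trans dc.
apply: near_eq_cvg; apply: nearW => t /=.
by rewrite /shift/= addr0 -[t *: 1]/(t * 1) mulr1.
Qed.

Hypothesis phi_flow : is_flow F phi.

Lemma flow_cvg z : (fun t => t^-1 *: (phi t z - z)) @ 0^'+ --> F z.
Proof.
have [phi0 dphi _] := phi_flow z; have := dphi 0; rewrite phi0.
by move=> /is_derive_cvg_right; rewrite phi0.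
Qed.

Lemma flow_koopman_cvg f z : differentiable f z ->
  (fun t => t^-1 * (f (phi t z) - f z)) @ 0^'+ --> koopman_gen F f z.
Proof.
move=> fz; have [phi0 dphi _] := phi_flow z.
have [d0 dE] := dphi 0; have /derivable1_diffP d0' := d0.
rewrite phi0 in dE; rewrite koopman_genE// deriveE// -dE deriveE//.
have fz0 : differentiable f (phi 0 z) by rewrite phi0.
have dcomp : is_derive (0 : R) (1 : R) (f \o phi ^~ z) ('d f (phi 0 z) ('d (phi ^~ z) 0 1)).
  split; first by apply: diff_derivable; exact: differentiable_comp.
  rewrite deriveE; last exact: differentiable_comp.
  exact: (congr1 (fun k => k 1) (diff_comp d0' fz0)).
by have := is_derive_cvg_right dcomp; rewrite /comp phi0.
Qed.

(* Both sides are the limit of the difference quotients along the flow. *)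
Lemma koopman_gen_coord (j : 'I_n) z : koopman_gen F (coord_fun j) z = F z 0 j.
Proof.
have /flow_koopman_cvg h1 : differentiable (coord_fun j : _ -> R) z by exact: differentiable_coord.
have /cvg_mxP/(_ 0 j) h2 := @flow_cvg z.
apply: (cvg_unique _ h1 _) => //; apply: cvg_trans h2.
by apply: near_eq_cvg; apply: nearW => t /=; rewrite !mxE.
Qed.

End flow.

(** * The limit of the estimates *)

Section lifting_limit.
Context {R : realType} {n : nat}.
Context (F : 'rV[R]_n -> 'rV[R]_n) (phi : R -> 'rV[R]_n -> 'rV[R]_n) (X : set 'rV[R]_n).
Context (g : nat -> 'rV[R]_n -> R) (z : nat -> 'rV[R]_n) (j : 'I_n).
Hypotheses (phi_flow : is_flow F phi) (g_C1 : forall l, C1_near X (g l)).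
Hypotheses (Xz : forall k, X (z k)) (det_z : forall K, \det (data_mx g K K z) != 0).

Lemma C1_near_differentiable f y : C1_near X f -> X y -> differentiable f y.
Proof. by move=> [U [_ XU fU]] /XU /fU[]. Qed.

Lemma col_mulmx m p q (A : 'M[R]_(m, p)) (B : 'M[R]_(p, q)) i :
  col i (A *m B) = A *m col i B.
Proof. by rewrite !colE mulmxA. Qed.

(** A row vector annihilating the data matrix also annihilates its first [K] columns, an invertible
    square block. *)
Lemma data_mx_row_free K N : (K <= N)%N -> row_free (data_mx g K N z).
Proof.
move=> KN; apply: inj_row_free => v v0.
have : v *m data_mx g K K z = 0.
  apply/rowP => l; have /rowP/(_ (widen_ord KN l)) := v0.
  rewrite mxE [RHS]mxE => v0l; rewrite mxE [RHS]mxE -[RHS]v0l.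
  by apply: eq_bigr => k _; rewrite !mxE.
move=> /(congr1 (fun w => w *m invmx (data_mx g K K z))).
by rewrite mulmxK ?mul0mx// unitmxE unitfE.
Qed.

Definition koopman_mx K N : 'M[R]_(K, N) := \matrix_(k, l) koopman_gen F (g l) (z k).

(** The limit of [lift_est] for a vanishing sampling period ([lift_est_cvg]): the logarithm is
    replaced by its first order term. *)
Definition gen_est K N : 'M[R]_(K, n) :=
  koopman_mx K N *m Defs.pinv (data_mx g K N z) *m \matrix_(k < K) z k.

(** Full row rank makes [P_x P_x^+] the identity, so the quotient is that of [P_y - P_x] times a
    constant matrix. *)
Lemma lift_ratio_cvg K N : (K <= N)%N ->
  (fun t => t^-1 *: (lift_ratio g K N z (fun k => phi t (z k)) - 1)) @ 0^'+ -->
    koopman_mx K N *m Defs.pinv (data_mx g K N z).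
Proof.
move=> KN.
have H : (fun t => t^-1 *: (data_mx g K N (fun k => phi t (z k)) - data_mx g K N z)) @ 0^'+
    --> koopman_mx K N.
  apply/cvg_mxP => k l; rewrite mxE.
  have := flow_koopman_cvg phi_flow (C1_near_differentiable (g_C1 l) (Xz k)).
  by apply: cvg_trans; apply: near_eq_cvg; apply: nearW => t; rewrite !mxE.
apply: (cvg_trans _ (cvg_mulmx H (cvg_cst (Defs.pinv (data_mx g K N z))))).
apply: near_eq_cvg; apply: nearW => t.
by rewrite -scalemxAl mulmxBl mulmx_pinv// data_mx_row_free.
Qed.

Lemma has_mlog_lift_ratio K N : (K <= N)%N ->
  \forall t \near 0^'+, has_mlog (lift_ratio g K N z (fun k => phi t (z k))).
Proof. by move=> /lift_ratio_cvg/mlog_cvg[]. Qed.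

Lemma lift_est_cvg K N (k : 'I_K) : (K <= N)%N ->
  (fun t => `|F (z k) 0 j - lift_est g K N t z (fun k => phi t (z k)) k j|) @ 0^'+ -->
    `|F (z k) 0 j - gen_est K N k j|.
Proof.
move=> KN; have [_ H] := mlog_cvg (lift_ratio_cvg KN).
apply: cvg_norm; apply: cvgB; first exact: cvg_cst.
suff /cvg_mxP : (fun t => lift_est g K N t z (fun k => phi t (z k))) @ 0^'+ --> gen_est K N.
  exact.
by apply: cvg_mulmx; [exact: H|exact: cvg_cst].
Qed.

(** The span relation holds on [X] only, so it cannot be differentiated in all directions. Forward
    invariance keeps the trajectory in [X] for positive times, and both sides are limits of the same
    difference quotients along it. *)
Lemma gen_est_span K (k : 'I_K) : forward_invariant phi X ->
  in_span X g K (coord_fun j) -> gen_est K K k j = F (z k) 0 j.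
Proof.
move=> inv [c cE].
have zc : col j (\matrix_(k < K) z k) = data_mx g K K z *m \col_l c l.
  apply/colP => i; rewrite !mxE -[LHS]/(coord_fun j (z i)) cE//.
  by apply: eq_bigr => l _; rewrite !mxE mulrC.
have -> : gen_est K K k j = \sum_(l < K) c l * koopman_gen F (g l) (z k).
  transitivity (col j (gen_est K K) k 0); first by rewrite [RHS]mxE.
  rewrite /gen_est col_mulmx zc -mulmxA [X in _ *m X]mulmxA.
  (* For a square data matrix the pseudoinverse is a two-sided inverse, so it recovers the
     coefficients [c]. *)
  rewrite (mulmx1C (mulmx_pinv (data_mx_row_free (leqnn K)))) mul1mx mxE.
  by apply: eq_bigr => l _; rewrite !mxE mulrC.
rewrite -(koopman_gen_coord phi_flow).
have h1 := flow_koopman_cvg phi_flow (differentiable_coord (z k) 0 j).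
apply: (cvg_unique _ _ h1) => //=.
have Hl (l : 'I_K) := flow_koopman_cvg phi_flow (C1_near_differentiable (g_C1 l) (Xz k)).
have : (fun t => \sum_(l < K) c l * (t^-1 * (g l (phi t (z k)) - g l (z k)))) @ 0^'+ -->
    \sum_(l < K) c l * koopman_gen F (g l) (z k).
  apply: cvg_big => [|l _]; first exact: add_continuous.
  apply: cvgM; first exact: cvg_cst.
  exact: Hl.
apply: cvg_trans; apply: near_eq_cvg; near=> t.
have Xt : X (phi t (z k)) by apply: (inv t); [near: t; exact: nbhs_right_gt|exists (z k)].
rewrite -[_ 0 j]/(coord_fun j _) -[X in _ - X]/(coord_fun j _) !cE// -sumrB mulr_sumr.
by apply: eq_bigr => l _; rewrite -mulrBr mulrCA.
Unshelve. all: by end_near. Qed.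

(** The projection of [f_j] is a finite combination of the [g l], differentiable at [z k]. Applying
    [L] to [h] there gives the signed error, which the second term of the graph norm dominates; the
    first is nonnegative. *)
Lemma gen_est_le_graph_norm K N (k : 'I_K) : (K <= N)%N ->
  (`|F (z k) 0 j - gen_est K N k j|%:E <=
   graph_norm F X (lift_proj g K N z (coord_fun j) \- coord_fun j)%R)%E.
Proof.
move=> KN; set h := lift_proj _ _ _ _ _ \- _.
pose c := Defs.pinv (data_mx g K N z) *m \col_k coord_fun j (z k).
have hE : h = \sum_(l < N) c l 0 *: (g l : 'rV[R]_n -> R) - coord_fun j.
  apply/funext => y; transitivity (lift_proj g K N z (coord_fun j) y - coord_fun j y) => //.
  rewrite lift_projE ?data_mx_row_free//.
  rewrite -[RHS]/((\sum_(l < N) c l 0 *: (g l : 'rV[R]_n -> R)) y - coord_fun j y); congr (_ - _).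
  rewrite -mulmxA mxE fct_sumE; apply: eq_bigr => l _.
  by rewrite mxE mulrC.
have dg l : differentiable (g l) (z k) by exact: C1_near_differentiable (g_C1 l) (Xz k).
have dcoord : differentiable (coord_fun j : _ -> R) (z k) by exact: differentiable_coord.
have dcg l : differentiable (c l 0 *: (g l : 'rV[R]_n -> R)) (z k) by exact: differentiableZ.
have dh : differentiable h (z k).
  by rewrite hE; apply: differentiableB => //; exact: differentiable_sum.
have kE : koopman_gen F h (z k) = gen_est K N k j - F (z k) 0 j.
  rewrite koopman_genE// hE deriveB; last 2 first.
  - by apply: derivable_sum => l; exact: diff_derivable.
  - exact: diff_derivable.
  rewrite -[X in _ - X]koopman_genE// (koopman_gen_coord phi_flow); congr (_ - _).
  rewrite derive_sum; last by move=> l; exact: diff_derivable.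
  transitivity (col j (gen_est K N) k 0); last by rewrite mxE.
  rewrite /gen_est col_mulmx -mulmxA.
  have -> : col j (\matrix_(k < K) z k) = \col_k coord_fun j (z k).
    by apply/colP => i; rewrite !mxE.
  rewrite -/c mxE; apply: eq_bigr => l _.
  rewrite deriveZ; last exact: diff_derivable.
  by rewrite -koopman_genE// [koopman_mx _ _ _ _]mxE [RHS]mulrC.
have sup_ge f : (`|f (z k)|%:E <= sup_norm X f)%E.
  by apply: ereal_sup_ubound; exists (z k).
rewrite distrC -kE (le_trans (sup_ge _))// /graph_norm leeDr//.
exact: le_trans (sup_ge h).
Qed.

End lifting_limit.

(** * Upper limits and the proof of both claims *)

Section esup.
Context {R : realType}.
Local Open Scope ereal_scope.

Lemma le_limn_esup (u v : (\bar R)^nat) : (forall n, u n <= v n) ->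
  limn_esup u <= limn_esup v.
Proof.
move=> uv; rewrite !limn_esup_lim; apply: lee_lim; [exact: is_cvg_esups|exact: is_cvg_esups|].
apply: nearW => n; apply: ge_ereal_sup => _ [m nm <-].
by apply: le_trans (uv m) _; apply: ereal_sup_ubound; exists m.
Qed.

Lemma limn_esup_ge0 (u : (\bar R)^nat) : (forall n, 0 <= u n) -> 0 <= limn_esup u.
Proof.
move=> u0; rewrite limn_esup_lim; apply: lime_ge; first exact: is_cvg_esups.
apply: nearW => n; apply: le_trans (u0 n) _; apply: ereal_sup_ubound.
by exists n => /=.
Qed.

End esup.

Theorem theorem2 (R : realType) (n : nat)
  (F : 'rV[R]_n -> 'rV[R]_n) (phi : R -> 'rV[R]_n -> 'rV[R]_n)
  (X : set 'rV[R]_n)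
  (d : measure_display) (Omega : measurableType d) (P : probability Omega R)
  (x : nat -> {RV P >-> borel_rV R n})
  (g : nat -> 'rV[R]_n -> R) (j : 'I_n)
  (F_continuous : continuous F)
  (phi_flow : is_flow F phi)
  (phi_invertible : flow_invertible phi)
  (phi_nonsingular : flow_nonsingular phi)
  (X_compact : compact X)
  (X_invariant : forward_invariant phi X)
  (X_positive : (0 < lebesgue_rV n X)%E)
  (x_independent : mutually_independent x)
  (x_uniform : forall k, uniform_on X (x k))
  (g_C1 : forall l, C1_near X (g l))
  (g_nondegenerate : basis_nondegenerate X g) :
  let xs (w : Omega) (k : nat) : 'rV[R]_n := x k w in
  let ys (Ts : R) (w : Omega) (k : nat) : 'rV[R]_n := phi Ts (x k w) in
  (forall K : nat, in_span X g K (coord_fun j) ->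
    {ae P, forall w,
      (\forall Ts \near 0^'+, has_mlog (lift_ratio g K K (xs w) (ys Ts w))) /\
      forall k : 'I_K,
        `|F (xs w k) 0 j - lift_est g K K Ts (xs w) (ys Ts w) k j|
          @[Ts --> 0^'+] --> 0}) /\
  ({ae P, forall w,
      limn_esup (fun N =>
          graph_norm F X
            (lift_proj g K N (xs w) (coord_fun j) \- coord_fun j))
        @[K --> \oo] --> 0%E} ->
    {ae P, forall w, forall k : nat,
      exists e : nat -> nat -> R,
        (forall (K N : nat) (kK : (k < K)%N), (K <= N)%N ->
          (\forall Ts \near 0^'+,
             has_mlog (lift_ratio g K N (xs w) (ys Ts w))) /\
          `|F (xs w k) 0 j
              - lift_est g K N Ts (xs w) (ys Ts w) (Ordinal kK) j|
            @[Ts --> 0^'+] --> e K N) /\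
        limn_esup (fun N => (e K N)%:E) @[K --> \oo] --> 0%E}).
Proof.
move=> xs ys.
have good := det_data_mx_ae X_compact x_independent x_uniform g_C1 g_nondegenerate.
split=> [K fspan|hyp].
  apply: filterS good => w [Xw dw]; split.
    exact: (has_mlog_lift_ratio phi_flow g_C1 Xw dw).
  move=> k; have := lift_est_cvg (j := j) (k := k) phi_flow g_C1 Xw dw (leqnn K).
  by rewrite (gen_est_span phi_flow g_C1 Xw dw)// subrr normr0.
apply: filterS2 good hyp => w [Xw dw] hw k.
(* The limits for a vanishing sampling period, with default value 0 when [k >= K] or [N < K], so
   that the bound by the graph norm persists there. *)
pose e K N : R := if insub k is Some i then
  if (K <= N)%N then `|F (xs w k) 0 j - gen_est F g (xs w) K N i j| else 0 else 0.
have e_ge0 K N : 0 <= e K N by rewrite /e; case: insubP => // i _ _; case: ifP.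
exists e; split=> [K N kK KN|].
  split; first exact: (has_mlog_lift_ratio phi_flow g_C1 Xw dw).
  rewrite /e insubT KN.
  exact: (lift_est_cvg (j := j) (k := Ordinal kK) phi_flow g_C1 Xw dw KN).
(* Nonnegativity of a supremum over [X] needs a point of [X]: the first sample point. *)
have graph_ge0 f : (0 <= graph_norm F X f)%E.
  have sup_ge0 h : (0 <= sup_norm X h)%E.
    apply: (@le_trans _ _ `|h (xs w 0)|%:E) => //; apply: ereal_sup_ubound.
    by exists (xs w 0) => //; exact: Xw.
  by rewrite adde_ge0.
apply: (squeeze_cvge _ (cvg_cst 0%E) hw); apply: nearW => K; apply/andP; split.
  by apply: limn_esup_ge0 => N; rewrite lee_fin.
apply: le_limn_esup => N; rewrite /e; case: insubP => [i _ ik|_] //.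
case: ifP => // KN; rewrite -ik.
exact: (gen_est_le_graph_norm j phi_flow g_C1 Xw dw i KN).
Qed.
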